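(* Let $Z\hookrightarrow Z_0$ be separable Hilbert spaces, and let $(X_t)_{t\ge0}$ be a $Z$-valued Markov process with transition probability kernel $p_t(\xi,dx)$ and $C_b$-Feller transition semigroup $(P_t)_{t\ge0}$. Suppose that for some $p\in[1,\infty)$ there exists a constant $C_p>0$ such that $$\int_Z\|y\|_Z^{2p}\,p_t(x,dy)\le C_p(1+\|x\|_Z^{2p})\qquad\text{for all }t\ge0,$$ that $X$ admits a unique invariant measure $\pi\in\mathcal P_{2p}(Z)$, and that there exists $\lambda>0$ such that $$\mathcal W_{1,Z_0}(p_t(\xi,\cdot),\pi)\lesssim(1+\|\xi\|_Z)(1\vee t)^{-\lambda},\qquad t\ge0,\ \xi\in Z.$$ Fix $\gamma\in(0,1]$ and let $f:Z_0\to\mathbb R$ satisfy, for some constant $C_f>0$, $$|f(x)-f(y)|\le C_f(1+\|x\|_{Z_0}^p+\|y\|_{Z_0}^p)^{1-\gamma}\|x-y\|_{Z_0}^\gamma,\qquad x,y\in Z_0.$$ Then the process $X$ satisfies the Law of Large Numbers in the mean-square sense, i.e. $$\mathbb E\left[\left|\frac1T\int_0^Tf(X_t)\,dt-\pi(f)\right|^2\right]\lesssim\left(1+\mathbb E[\|X_0\|_Z^{2p}]+\int_Z\|y\|_Z^{2p}\,\pi(dy)\right)T^{-(1\wedge\gamma\lambda)}(\log(T))^{\mathbf 1_{\{\gamma\lambda=1\}}}$$ holds, where $\pi(f)=\int_Zf(x)\,\pi(dx)$.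
   Context: $Z\hookrightarrow Z_0$ denotes a continuous embedding. $x\lesssim y$ means inequality up to a multiplicative constant, i.e. $x\le cy$; $a\vee b=\max\{a,b\}$, $a\wedge b=\min\{a,b\}$. $\mathcal P_{2p}(Z)$ is the set of Borel probability measures on $Z$ with finite $2p$-th moment of $\|\cdot\|_Z$. Measures on $Z$ are regarded as measures on $Z_0$ through the embedding, and $\mathcal W_{1,Z_0}$ is the $1$-Wasserstein distance with respect to $\|\cdot\|_{Z_0}$. $C_b$-Feller means that $P_tf(x)=\int_Zf(y)\,p_t(x,dy)$ maps bounded continuous functions on $Z$ to bounded continuous functions on $Z$.
   Formalization: When γλ = 1 the bound is claimed only for T ≥ T0, with T0 > 1 arbitrary and the constant depending on T0, since log(T) vanishes at T = 1 and is negative below it; X is assumed jointly measurable in (t, ω) so that the time integral makes sense. *)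

(* Defs.v *)
From HB Require Import structures.
From mathcomp Require Import all_boot all_order all_algebra sesquilinear.
From mathcomp Require Import all_classical all_reals all_analysis.

Set Implicit Arguments.
Unset Strict Implicit.
Unset Printing Implicit Defensive.
Import Order.TTheory GRing.Theory Num.Theory.
Import numFieldNormedType.Exports.
Local Open Scope classical_set_scope.
Local Open Scope ring_scope.

(** The norm comes from a real inner product.  Completeness is part of the type
    [completeNormedModType R], so a Hilbert space is such a type whose norm
    satisfies this predicate. *)
Definition hilbert_norm (R : realType) (V : completeNormedModType R) : Prop :=
  exists dot : {dot V for (@idfun R)}, forall x : V, dot x x = `|x| ^+ 2.

Definition separable_space (V : topologicalType) : Prop :=
  exists D : set V, countable D /\ dense D.

Definition borelType (V : ptopologicalType) := g_sigma_algebraType (@open V).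

Section wasserstein.
Local Open Scope ereal_scope.
Context (R : realType) (V : normedModType R).

(** For separable [V] the product sigma-algebra carried by
    [borelType V * borelType V] is the Borel one of [V * V], so this is the
    usual notion. *)
Definition coupling (m n : set (borelType V) -> \bar R)
    (g : probability (borelType V * borelType V)%type R) : Prop :=
  forall A : set (borelType V), measurable A ->
    g (A `*` setT) = m A /\ g (setT `*` A) = n A.

Definition wasserstein1 (m n : set (borelType V) -> \bar R) : \bar R :=
  ereal_inf [set \int[g]_z (`| (z.1 : V) - (z.2 : V) |%R)%:E |
    g in [set g : probability (borelType V * borelType V)%type R |
          coupling m n g]].

End wasserstein.

Section markov.
Local Open Scope ereal_scope.
Context (R : realType) (d : measure_display) (S : measurableType d).
Implicit Types p : R -> R.-pker S ~> S.

(** Times range over [R]; only nonnegative ones are ever constrained or used. *)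
Definition transition_kernels p : Prop :=
  (forall x A, measurable A -> p 0%R x A = \d_x A) /\
  (forall s t, (0 <= s)%R -> (0 <= t)%R ->
   forall x A, measurable A -> p (s + t)%R x A = \int[p s x]_y p t y A).

Definition invariant_measure p (mu : probability S R) : Prop :=
  forall t, (0 <= t)%R ->
  forall A, measurable A -> \int[mu]_x p t x A = mu A.

(** Measures are set functions on all subsets, hence equality is only required
    on measurable sets. *)
Definition unique_invariant_measure p (mu : probability S R) : Prop :=
  invariant_measure p mu /\
  forall nu : probability S R, invariant_measure p nu ->
    forall A, measurable A -> nu A = mu A.

Context (dO : measure_display) (Omega : measurableType dO).

Definition natural_filtration (X : R -> Omega -> S) (s : R) :
    set (set Omega) :=
  <<s [set E | exists u B, [/\ (0 <= u <= s)%R, measurable B &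
                               E = X u @^-1` B]] >>.

(** The second clause is P(X_{s+t} \in B | F_s) = p_t(X_s, B) almost surely,
    with the conditional expectation written out. *)
Definition markov_process (P : probability Omega R) p
    (X : R -> Omega -> S) : Prop :=
  (forall t, (0 <= t)%R -> measurable_fun setT (X t)) /\
  (forall s t, (0 <= s)%R -> (0 <= t)%R ->
   forall A, natural_filtration X s A -> forall B, measurable B ->
     P (A `&` X (s + t)%R @^-1` B) = \int[P]_(w in A) p t (X s w) B).

(** Joint measurability in (t, w), which makes the time integrals of the
    process meaningful. *)
Definition measurable_process (X : R -> Omega -> S) : Prop :=
  measurable_fun ([set t : R | (0 <= t)%R] `*` [set: Omega])
    (fun z : R * Omega => X z.1 z.2).

End markov.

Definition semigroup (R : realType) (V : ptopologicalType)
    (p : R -> R.-pker (borelType V) ~> (borelType V)) (t : R) (h : V -> R) :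
    V -> R :=
  fun x => \int[p t x]_y h y.

Definition Cb (R : realType) (V : topologicalType) (h : V -> R) : Prop :=
  continuous h /\ exists M : R, forall x, `|h x| <= M.

Definition Cb_Feller (R : realType) (V : ptopologicalType)
    (p : R -> R.-pker (borelType V) ~> (borelType V)) : Prop :=
  forall t, 0 <= t -> forall h : V -> R, Cb h -> Cb (semigroup p t h).

(** [\int ||y||^q m(dy)], as an extended real. *)
Definition moment (R : realType) (V : normedModType R) (q : R)
    (m : {measure set (borelType V) -> \bar R}) : \bar R :=
  (\int[m]_y (`| (y : V) | `^ q)%:E)%E.

(* Main.v *)
Require Import Defs.
From HB Require Import structures.
From mathcomp Require Import all_boot all_order all_algebra sesquilinear.
From mathcomp Require Import all_classical all_reals all_analysis.
From mathcomp Require Import finmap ring lra measurable_realfun.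

Set Implicit Arguments.
Unset Strict Implicit.
Unset Printing Implicit Defensive.
Import Order.TTheory GRing.Theory Num.Theory.
Import numFieldNormedType.Exports.
Local Open Scope classical_set_scope.
Local Open Scope ring_scope.

(** Write [g] for [f o iota] minus its [mu]-mean, [V x] for [1 + |x|^p], and
    [kappa u] for [(1 \/ u)^(- gamma lambda)].  The mean square of the time
    average of [g] is [T^-2] times the integral of [E (g (X_s) g (X_t))] over the
    square [[0, T]^2].  For [s <= t] the Markov property replaces [g (X_t)] by
    [P_(t-s) g (X_s)], so that a bound [|P_u g| <= C kappa(u) V] makes the
    integrand at most [C' kappa(|t - s|) E (V (X_s)^2)]; the last expectation is
    bounded uniformly in [s] by the moment assumption, and the integral of
    [kappa(|t - s|)] over [t] in [[0, T]] is of order [T] times the announced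
    rate ([integral_decay_le]).

    The bound on [P_u g] ([wasserstein1_holder], [semigroup_mixing]) comes from
    an almost optimal coupling of [p_u(x, .)] and [mu].  With
    [r = (1 \/ u)^(- lambda)], the inequality [a^(1-gamma) b^gamma <= a + b]
    turns the Holder condition into
    [|f y - f z| <= Cf r^gamma (1 + |y|^p + |z|^p + |y - z| / r)].  Integrating
    it against the coupling, the factor [r^gamma] is the decay that is wanted,
    the distance costs [W_1 / r], which is of order [1 + |x|], and the [p]-th
    moments are of order [V x].

    Since [g] is signed and unbounded, the computation is carried out on its
    positive and negative parts, with integrals in [[0, +oo]].  The time
    integrals [U] and [W] of these parts satisfy
    [(U - W)^2 + 2 U W <= U^2 + W^2] for every outcome, including those for
    which the time integral of [g] diverges, where the right-hand side is
    infinite.  Tonelli's theorem and the Markov property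
    ([markov_decorrelation]) give [E (U^2 + W^2) <= 2 E (U W) + K], and the
    finite quantity [2 E (U W)] cancels ([mean_square_le]). *)

(** * Functions of a Markov process at two times *)

Section measurable_induction.
Local Open Scope ereal_scope.
Context d (T : measurableType d) (R : realType).
Import HBNNSimple.

(** The standard machine.  It is stated for a predicate on functions because it
    is used with functionals that are not integrals against a single measure. *)
Lemma ge0_measurable_ind (Q : (T -> \bar R) -> Prop) :
  (forall A, measurable A -> Q (fun x => (\1_A x)%:E)) ->
  (forall (c : R) (f : T -> \bar R), (0 <= c)%R -> (forall x, 0 <= f x) ->
     measurable_fun setT f -> Q f -> Q (fun x => c%:E * f x)) ->
  (forall f g : T -> \bar R, (forall x, 0 <= f x) -> (forall x, 0 <= g x) ->
     measurable_fun setT f -> measurable_fun setT g ->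
     Q f -> Q g -> Q (fun x => f x + g x)) ->
  (forall (f_ : (T -> \bar R)^nat) (f : T -> \bar R),
     (forall n x, 0 <= f_ n x) -> (forall n, measurable_fun setT (f_ n)) ->
     (forall x, nondecreasing_seq (f_ ^~ x)) ->
     (forall x, f_ ^~ x @ \oo --> f x) ->
     (forall n, Q (f_ n)) -> Q f) ->
  forall f : T -> \bar R, (forall x, 0 <= f x) -> measurable_fun setT f -> Q f.
Proof.
move=> Q1 QZ QD Qlim f f0 mf.
pose g := nnsfun_approx measurableT mf.
apply: (Qlim (fun n x => (g n x)%:E)).
- by move=> n x; rewrite lee_fin; exact: fun_ge0.
- by move=> n; apply/measurable_EFinP.
- by move=> x a b ab; rewrite lee_fin; exact/lefP/nd_nnsfun_approx.
- by move=> x; exact: cvg_nnsfun_approx.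
move=> n.
have Q0 : Q (fun=> 0).
  have := Q1 set0 measurable0; congr Q.
  by apply/funext => x; rewrite indic0.
have -> : (fun x => (g n x)%:E) =
    (fun x => \sum_(r <- fset_set (range (g n)))
       (r * \1_(g n @^-1` [set r]) x)%:E).
  by apply/funext => x; rewrite fimfunE fsbig_finite// sumEFin.
have : forall r, r \in (fset_set (range (g n)) : seq R) -> (0 <= r)%R.
  move=> r rg; have : r \in fset_set (range (g n)) by [].
  by rewrite in_fset_set// => /set_mem[x _ <-]; exact: fun_ge0.
elim: (enum_fset _) => [_|r s ih rs].
  by under eq_fun do rewrite big_nil.
under eq_fun do rewrite big_cons.
have r0 : (0 <= r)%R by apply: rs; rewrite mem_head.
have ms : measurable (g n @^-1` [set r]) by exact: measurable_funPTI.
apply: QD.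
- by move=> x; rewrite lee_fin mulr_ge0.
- move=> x; rewrite big_seq; apply: sume_ge0 => t ts.
  by rewrite lee_fin mulr_ge0// rs// inE ts orbT.
- by apply/measurable_EFinP; exact: measurable_funM.
- apply: emeasurable_sum => t.
  by apply/measurable_EFinP; exact: measurable_funM.
- under eq_fun do rewrite EFinM.
  apply: QZ => //; last exact: Q1.
  by apply/measurable_EFinP.
- by apply: ih => t ts; apply: rs; rewrite inE ts orbT.
Qed.

End measurable_induction.

Section markov_two_times.
Local Open Scope ereal_scope.
Context (R : realType) (d : measure_display) (S : measurableType d)
  (dO : measure_display) (Omega : measurableType dO)
  (P : probability Omega R) (k : R.-pker S ~> S) (X Y : Omega -> S).
Hypotheses (mX : measurable_fun setT X) (mY : measurable_fun setT Y).
Hypothesis XY : forall A B, measurable A -> measurable B ->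
  P (X @^-1` A `&` Y @^-1` B) = \int[P]_(w in X @^-1` A) k (X w) B.

Let mXA A : measurable A -> measurable (X @^-1` A).
Proof. by move=> mA; rewrite -[_ @^-1` _]setTI; exact: mX. Qed.

Let mYA A : measurable A -> measurable (Y @^-1` A).
Proof. by move=> mA; rewrite -[_ @^-1` _]setTI; exact: mY. Qed.

Let mk (b : S -> \bar R) : (forall x, 0 <= b x) -> measurable_fun setT b ->
  measurable_fun setT (fun x => \int[k x]_y b y).
Proof.
by move=> b0 mb; apply: measurable_fun_integral_kernel => // U mU; exact: measurable_kernel.
Qed.

(** The hypothesis is the case of an indicator function. *)
Lemma markov_integral_on A (b : S -> \bar R) : measurable A ->
  (forall x, 0 <= b x) -> measurable_fun setT b ->
  \int[P]_(w in X @^-1` A) b (Y w) =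
  \int[P]_(w in X @^-1` A) \int[k (X w)]_y b y.
Proof.
move=> mA; have mA' := mXA mA; move: b.
have mbY (b : S -> \bar R) : measurable_fun setT b ->
    measurable_fun (X @^-1` A) (fun w => b (Y w)).
  by move=> mb; exact: (measurable_funTS (measurableT_comp mb mY)).
have mkX b : (forall x, 0 <= b x) -> measurable_fun setT b ->
    measurable_fun (X @^-1` A) (fun w => \int[k (X w)]_y b y).
  by move=> b0 mb; exact: (measurable_funTS (measurableT_comp (mk b0 mb) mX)).
have kX0 b : (forall x, 0 <= b x) ->
    forall w, (X @^-1` A) w -> 0 <= \int[k (X w)]_y b y.
  by move=> b0 w _; apply: integral_ge0 => y _; exact: b0.
apply: ge0_measurable_ind
  => [B mB|c b c0 b0 mb ih|b1 b2 b10 b20 m1 m2 ih1 ih2|b_ b b0 mb ndb bb ih].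
- under [in RHS]eq_integral => w _ do rewrite integral_indic// setIT.
  rewrite -XY//.
  rewrite (_ : (fun w => _) = (fun w => (\1_(Y @^-1` B) w)%:E))//.
  by rewrite integral_indic; [rewrite setIC|exact: mA'|exact: mYA].
- rewrite (ge0_integralZl_EFin P mA' (fun w _ => b0 (Y w)) (mbY _ mb) c0) ih.
  rewrite -(ge0_integralZl_EFin P mA' (kX0 _ b0) (mkX _ b0 mb) c0).
  apply: eq_integral => w _.
  by rewrite (ge0_integralZl_EFin _ measurableT (fun y _ => b0 y) mb c0).
- rewrite (ge0_integralD P mA' (fun w _ => b10 (Y w)) (mbY _ m1)
    (fun w _ => b20 (Y w)) (mbY _ m2)) ih1 ih2.
  rewrite -(ge0_integralD P mA' (kX0 _ b10) (mkX _ b10 m1)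
    (kX0 _ b20) (mkX _ b20 m2)).
  apply: eq_integral => w _.
  by rewrite (ge0_integralD _ measurableT (fun y _ => b10 y) m1
    (fun y _ => b20 y) m2).
- have E (w : Omega) : b (Y w) = limn (b_ ^~ (Y w)) by apply/esym/cvg_lim => //; exact: bb.
  under eq_integral => w _ do rewrite E.
  rewrite monotone_convergence//; last first.
    by move=> n; apply: measurable_funTS; exact: measurableT_comp.
  under eq_fun do rewrite ih.
  rewrite -monotone_convergence//; last 3 first.
  + move=> n; apply: measurable_funTS; apply: (measurableT_comp (mk (b0 n) (mb n))) => //.
  + by move=> n w _; exact: integral_ge0.
  + by move=> w _ m n mn; apply: ge0_le_integral => // y _; exact: ndb.
  apply: eq_integral => w _; rewrite -monotone_convergence//.
  by apply: eq_integral => y _; apply/cvg_lim => //; exact: bb.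
Qed.

(** For fixed [b] both sides are additive and continuous along monotone limits
    in [a], and [markov_integral_on] is the case where [a] is an indicator. *)
Lemma markov_integral_mul (a b : S -> \bar R) :
  (forall x, 0 <= a x) -> measurable_fun setT a ->
  (forall x, 0 <= b x) -> measurable_fun setT b ->
  \int[P]_w (a (X w) * b (Y w)) = \int[P]_w (a (X w) * \int[k (X w)]_y b y).
Proof.
move=> a0 ma b0 mb; move: a a0 ma.
have bY0 w : 0 <= b (Y w) by [].
have mbY : measurable_fun setT (fun w => b (Y w)) by exact: measurableT_comp.
have kX0 w : 0 <= \int[k (X w)]_y b y by exact: integral_ge0.
have mkX : measurable_fun setT (fun w => \int[k (X w)]_y b y).
  by apply: (measurableT_comp (mk b0 mb)).
apply: ge0_measurable_ind
  => [A mA|c a c0 a0 ma ih|a1 a2 a10 a20 m1 m2 ih1 ih2|a_ a a0 ma nda aa ih].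
- have E (h : Omega -> \bar R) : \int[P]_w ((\1_A (X w))%:E * h w) =
      \int[P]_(w in X @^-1` A) h w.
    rewrite [RHS]integral_mkcond; apply: eq_integral => w _.
    rewrite patchE indicE (_ : (w \in X @^-1` A) = (X w \in A)); last first.
      by apply/idP/idP => /set_mem XwA; exact/mem_set.
    by case: (X w \in A); rewrite ?mul1e ?mul0e.
  by rewrite !E; exact: markov_integral_on.
- under eq_integral do rewrite -muleA.
  under [RHS]eq_integral do rewrite -muleA.
  rewrite !ge0_integralZl//.
  + by rewrite ih.
  + by apply: emeasurable_funM => //; exact: measurableT_comp.
  + by move=> w _; rewrite mule_ge0.
  + by apply: emeasurable_funM => //; exact: measurableT_comp.
  + by move=> w _; rewrite mule_ge0.
- under eq_integral do rewrite ge0_muleDl//.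
  under [RHS]eq_integral do rewrite ge0_muleDl//.
  rewrite !ge0_integralD//.
  + by rewrite ih1 ih2.
  + by move=> w _; rewrite mule_ge0.
  + by apply: emeasurable_funM => //; exact: measurableT_comp.
  + by move=> w _; rewrite mule_ge0.
  + by apply: emeasurable_funM => //; exact: measurableT_comp.
  + by move=> w _; rewrite mule_ge0.
  + by apply: emeasurable_funM => //; exact: measurableT_comp.
  + by move=> w _; rewrite mule_ge0.
  + by apply: emeasurable_funM => //; exact: measurableT_comp.
- have E (h : Omega -> \bar R) : (forall w, 0 <= h w) -> measurable_fun setT h ->
      \int[P]_w (a (X w) * h w) = limn (fun n => \int[P]_w (a_ n (X w) * h w)).
    move=> h0 mh; rewrite -monotone_convergence//.
    (* [h w] may be infinite where [a] vanishes or vanish where [a] is infinite,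
       so the product of limits needs the two degenerate cases separately. *)
    + apply: eq_integral => w _; apply/esym/cvg_lim => //.
      have [->|h_neq0] := eqVneq (h w) 0.
        by rewrite mule0; under eq_fun do rewrite mule0; exact: cvg_cst.
      have [aw0|aw_neq0] := eqVneq (a (X w)) 0.
        have an0 n : a_ n (X w) = 0.
          apply/eqP; rewrite eq_le a0 andbT -aw0.
          have := ereal_nondecreasing_cvgn (nda (X w)).
          move=> /(cvg_unique _ (aa (X w))) -> //.
          by apply: ereal_sup_ubound; exists n.
        rewrite aw0 mul0e; under eq_fun do rewrite an0 mul0e.
        exact: cvg_cst.
      apply: cvgeM; [|exact: aa|exact: cvg_cst].
      by rewrite neq0_mule_def // mule_neq0.
    + by move=> n; apply: emeasurable_funM => //; exact: measurableT_comp.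
    + by move=> n w _; rewrite mule_ge0.
    + by move=> w _ m n mn; rewrite lee_wpmul2r//; exact: nda.
  by rewrite !E//; congr (limn _); apply/funext.
Qed.

End markov_two_times.

(** * Tonelli's theorem and mean squares of integrals *)

Section tonelli_product.
Local Open Scope ereal_scope.
Context (R : realType) (dS dO : measure_display) (S : measurableType dS)
  (Omega : measurableType dO).
Variables (m : {sigma_finite_measure set S -> \bar R})
  (P : {sigma_finite_measure set Omega -> \bar R}).

(** Tonelli's theorem twice: with one of the two integrals kept as a function of
    [w] only products of two spaces occur. *)
Lemma tonelli_mul_integral (u v : S * Omega -> \bar R) :
  (forall z, 0 <= u z) -> measurable_fun setT u ->
  (forall z, 0 <= v z) -> measurable_fun setT v ->
  \int[P]_w ((\int[m]_s u (s, w)) * (\int[m]_t v (t, w))) =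
  \int[m]_s \int[m]_t \int[P]_w (u (s, w) * v (t, w)).
Proof.
move=> u0 mu v0 mv.
pose V w := \int[m]_t v (t, w).
have V0 w : 0 <= V w by exact: integral_ge0.
have mV : measurable_fun setT V by exact: measurable_fun_fubini_tonelli_G.
have mus s : measurable_fun setT (fun w => u (s, w)) by exact: measurableT_comp.
have muw w : measurable_fun setT (fun s => u (s, w)) by exact: measurableT_comp.
have mvw w : measurable_fun setT (fun s => v (s, w)) by exact: measurableT_comp.
transitivity (\int[P]_w \int[m]_s (u (s, w) * V w)).
  by apply: eq_integral => w _; rewrite ge0_integralZr.
rewrite -(fubini_tonelli (fun z => u z * V z.2)); last 2 first.
- by apply: emeasurable_funM => //; exact: measurableT_comp.
- by move=> z; exact: mule_ge0.
apply: eq_integral => s _ /=.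
transitivity (\int[P]_w \int[m]_t (u (s, w) * v (t, w))).
  by apply: eq_integral => w _; rewrite ge0_integralZl.
rewrite -(fubini_tonelli (fun z => u (s, z.2) * v z))//.
- apply: emeasurable_funM => //.
  exact: (measurableT_comp (mus s) measurable_snd).
- by move=> z; exact: mule_ge0.
Qed.

Lemma measurable_integral_mul (a b : S * Omega -> \bar R) s :
  (forall z, 0 <= a z) -> measurable_fun setT a ->
  (forall z, 0 <= b z) -> measurable_fun setT b ->
  measurable_fun setT (fun t => \int[P]_w (a (s, w) * b (t, w))).
Proof.
move=> a0 ma b0 mb; apply: (measurable_fun_fubini_tonelli_F
  (fun z : S * Omega => a (s, z.2) * b z)); last by move=> z; exact: mule_ge0.
apply: emeasurable_funM => //.
have mas : measurable_fun setT (fun w => a (s, w)) by exact: measurableT_comp.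
exact: (measurableT_comp mas measurable_snd).
Qed.

Lemma measurable_integral_integral_mul (a b : S * Omega -> \bar R) :
  (forall z, 0 <= a z) -> measurable_fun setT a ->
  (forall z, 0 <= b z) -> measurable_fun setT b ->
  measurable_fun setT (fun s => \int[m]_t \int[P]_w (a (s, w) * b (t, w))).
Proof.
move=> a0 ma b0 mb.
rewrite (_ : (fun s => _) = (fun s => \int[P]_w (a (s, w) * \int[m]_t b (t, w)))).
  apply: (measurable_fun_fubini_tonelli_F
    (fun z : S * Omega => a z * \int[m]_t b (t, z.2))).
  + apply: emeasurable_funM => //.
    have mB' : measurable_fun setT (fun w => \int[m]_t b (t, w)).
      exact: measurable_fun_fubini_tonelli_G.
    exact: (measurableT_comp mB' measurable_snd).
  + by move=> z; apply: mule_ge0 => //; exact: integral_ge0.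
apply/funext => s.
have mas : measurable_fun setT (fun w => a (s, w)) by exact: measurableT_comp.
transitivity (\int[P]_w \int[m]_t (a (s, w) * b (t, w))).
  rewrite (fubini_tonelli (fun z : S * Omega => a (s, z.2) * b z))//.
  + apply: emeasurable_funM => //.
    exact: (measurableT_comp mas measurable_snd).
  + by move=> z; exact: mule_ge0.
apply: eq_integral => w _; rewrite ge0_integralZl//.
exact: measurableT_comp.
Qed.

End tonelli_product.

Section integral_add_le.
Local Open Scope ereal_scope.
Context (R : realType) (d : measure_display) (T : measurableType d)
  (m : {measure set T -> \bar R}).

Lemma integral_add_le (f1 f2 f3 f4 h : T -> \bar R) (H : \bar R) :
  (forall x, 0 <= f1 x) -> measurable_fun setT f1 ->
  (forall x, 0 <= f2 x) -> measurable_fun setT f2 ->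
  (forall x, 0 <= f3 x) -> measurable_fun setT f3 ->
  (forall x, 0 <= f4 x) -> measurable_fun setT f4 ->
  (forall x, 0 <= h x) -> measurable_fun setT h -> \int[m]_x h x <= H ->
  (forall x, f1 x + f2 x <= f3 x + f4 x + h x) ->
  \int[m]_x f1 x + \int[m]_x f2 x <= \int[m]_x f3 x + \int[m]_x f4 x + H.
Proof.
move=> f10 m1 f20 m2 f30 m3 f40 m4 h0 mh hH le.
have f340 x : 0 <= f3 x + f4 x by exact: adde_ge0.
have m34 : measurable_fun setT (fun x => f3 x + f4 x) by exact: emeasurable_funD.
apply: le_trans (leeD2l _ hH).
rewrite -(ge0_integralD m measurableT (fun x _ => f10 x) m1 (fun x _ => f20 x) m2).
rewrite -(ge0_integralD m measurableT (fun x _ => f30 x) m3 (fun x _ => f40 x) m4).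
rewrite -(ge0_integralD m measurableT (fun x _ => f340 x) m34 (fun x _ => h0 x) mh).
apply: ge0_le_integral => //.
- by move=> x _; exact: adde_ge0.
- exact: emeasurable_funD.
- exact: emeasurable_funD.
Qed.

End integral_add_le.

Section mean_square.
Local Open Scope ereal_scope.
Context (R : realType) (dS dO : measure_display) (S : measurableType dS)
  (Omega : measurableType dO).
Variables (m : {sigma_finite_measure set S -> \bar R})
  (P : {sigma_finite_measure set Omega -> \bar R}).

(** [Y] is to be thought of as the integral of [u - v].  Expanding the square
    produces the two-point functions of [u] and [v]; the mixed terms appear with
    the same coefficient on both sides and cancel because they are finite.  The
    last hypothesis is an inequality, hence can hold for every [w] even where
    [u - v] is not integrable. *)
Lemma mean_square_le (u v : S * Omega -> \bar R) (k : S -> S -> \bar R)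
    (K : \bar R) (Y : Omega -> R) :
  (forall z, 0 <= u z) -> measurable_fun setT u ->
  (forall z, 0 <= v z) -> measurable_fun setT v ->
  (forall s t, 0 <= k s t) -> (forall s, measurable_fun setT (k s)) ->
  (forall s t,
    \int[P]_w (u (s, w) * u (t, w)) + \int[P]_w (v (s, w) * v (t, w)) <=
    \int[P]_w (u (s, w) * v (t, w)) + \int[P]_w (v (s, w) * u (t, w))
    + k s t) ->
  forall B : S -> \bar R, (forall s, \int[m]_t k s t <= B s) ->
  measurable_fun setT B -> \int[m]_s B s <= K ->
  \int[m]_s \int[m]_t \int[P]_w (u (s, w) * v (t, w)) < +oo ->
  measurable_fun setT Y ->
  (forall w, (Y w ^+ 2)%:E + 2%:E * ((\int[m]_s u (s, w)) * (\int[m]_s v (s, w)))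
    <= (\int[m]_s u (s, w)) * (\int[m]_s u (s, w))
       + (\int[m]_s v (s, w)) * (\int[m]_s v (s, w))) ->
  \int[P]_w (Y w ^+ 2)%:E <= K.
Proof.
move=> u0 mu v0 mv k0 mk uvk B kB mB BK uvoo mY Yuv.
pose U w := \int[m]_s u (s, w); pose V w := \int[m]_s v (s, w).
have U0 w : 0 <= U w by exact: integral_ge0.
have V0 w : 0 <= V w by exact: integral_ge0.
have mU : measurable_fun setT U by exact: measurable_fun_fubini_tonelli_G.
have mV : measurable_fun setT V by exact: measurable_fun_fubini_tonelli_G.
have B0 s : 0 <= B s by apply: le_trans (kB s); exact: integral_ge0.
have uv_prod (a b : S * Omega -> \bar R) : (forall z, 0 <= a z) ->
    measurable_fun setT a -> (forall z, 0 <= b z) -> measurable_fun setT b ->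
    (forall s t, 0 <= \int[P]_w (a (s, w) * b (t, w))) /\
    (forall s, measurable_fun setT (fun t => \int[P]_w (a (s, w) * b (t, w)))) /\
    measurable_fun setT (fun s => \int[m]_t \int[P]_w (a (s, w) * b (t, w))).
  move=> a0 ma b0 mb; split; [|split].
  - by move=> s t; apply: integral_ge0 => w _; exact: mule_ge0.
  - by move=> s; exact: measurable_integral_mul.
  - exact: measurable_integral_integral_mul.
have [uu0 [muu mmuu]] := uv_prod _ _ u0 mu u0 mu.
have [vv0 [mvv mmvv]] := uv_prod _ _ v0 mv v0 mv.
have [uv0 [muv mmuv]] := uv_prod _ _ u0 mu v0 mv.
have [vu0 [mvu mmvu]] := uv_prod _ _ v0 mv u0 mu.
have sq_le : \int[P]_w (U w * U w) + \int[P]_w (V w * V w) <=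
             \int[P]_w (U w * V w) + \int[P]_w (V w * U w) + K.
  rewrite !tonelli_mul_integral//.
  have int0 (F : S -> S -> \bar R) : (forall s t, 0 <= F s t) ->
      forall s, 0 <= \int[m]_t F s t by move=> F0 s; exact: integral_ge0.
  apply: (integral_add_le (int0 _ uu0) mmuu (int0 _ vv0) mmvv
    (int0 _ uv0) mmuv (int0 _ vu0) mmvu B0 mB BK) => s.
  by apply: (integral_add_le (uu0 s) (muu s) (vv0 s) (mvv s)
    (uv0 s) (muv s) (vu0 s) (mvu s) (k0 s) (mk s) (kB s)) => t; exact: uvk.
have mY2 : measurable_fun setT (fun w => (Y w ^+ 2)%:E).
  by apply/measurable_EFinP; exact: measurable_funX.
have mUV : measurable_fun setT (fun w => U w * V w) by exact: emeasurable_funM.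
have UV0 w : 0 <= U w * V w by exact: mule_ge0.
have UVC : \int[P]_w (V w * U w) = \int[P]_w (U w * V w).
  by apply: eq_integral => w _; rewrite muleC.
have UVfin : \int[P]_w (U w * V w) \is a fin_num.
  by rewrite ge0_fin_numE; [rewrite tonelli_mul_integral|exact: integral_ge0].
have UU0 w : 0 <= U w * U w by exact: mule_ge0.
have mUU : measurable_fun setT (fun w => U w * U w) by exact: emeasurable_funM.
have VV0 w : 0 <= V w * V w by exact: mule_ge0.
have mVV : measurable_fun setT (fun w => V w * V w) by exact: emeasurable_funM.
have Y20 w : 0 <= (Y w ^+ 2)%:E by rewrite lee_fin sqr_ge0.
have UV20 w : 0 <= 2%:E * (U w * V w) by exact: mule_ge0.
have mUV2 : measurable_fun setT (fun w => 2%:E * (U w * V w)).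
  exact: measurable_funeM.
have : \int[P]_w (Y w ^+ 2)%:E + \int[P]_w (2%:E * (U w * V w)) <=
       \int[P]_w (U w * U w) + \int[P]_w (V w * V w) + 0.
  apply: (integral_add_le Y20 mY2 UV20 mUV2 UU0 mUU VV0 mVV
    (fun=> lexx 0) (measurable_cst 0) _ _).
  - by rewrite integral0.
  - by move=> w; rewrite adde0; exact: Yuv.
rewrite adde0 => /le_trans/(_ sq_le); rewrite UVC.
have -> : \int[P]_w (2%:E * (U w * V w)) = 2%:E * \int[P]_w (U w * V w).
  by apply: (ge0_integralZl_EFin P measurableT (fun w _ => UV0 w) mUV).
move: UVfin; move: (\int[P]_w (U w * V w)) => J Jfin.
have -> : 2%:E * J = J + J by rewrite -(fineK Jfin) -EFinM -EFinD mulr_natl mulr2n.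
have JJ : J + J \is a fin_num by rewrite fin_numD Jfin.
by rewrite addeC (leeD2lE _ _ JJ).
Qed.

End mean_square.

(** * The integral of a power of the time lag *)

Section one_over_distance.
Context (R : realType).
Local Notation leb := (@lebesgue_measure R).

(** The fundamental theorem of calculus on each side of [s]. *)
Lemma integral_two_sided (g G : R -> R) (T s : R) : 0 < T ->
  (forall x : R, 0 < x -> is_derive x 1 G (g x)) ->
  (forall x : R, 0 < x -> {for x, continuous g}) ->
  (\int[leb]_(t in `[s, (s + T)%R]) (g (1 + (t - s)))%:E = (G (1 + T) - G 1)%:E)%E /\
  (\int[leb]_(t in `[(s - T)%R, s]) (g (1 + (s - t)))%:E = (G (1 + T) - G 1)%:E)%E.
Proof.
move=> T0 dG cg.
have cont_G (x : R) : 0 < x -> {for x, continuous G}.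
  move=> x0; apply/differentiable_continuous/derivable1_diffP.
  by have [] := dG x x0.
split.
- pose F (t : R) := G (1 + (t - s)).
  have dF (t : R) : s - 1 < t -> is_derive t 1 F (g (1 + (t - s))).
    move=> st; have d1 : is_derive t (1:R) (fun t : R => 1 + (t - s)) 1.
      have := is_deriveD (is_derive_cst (1 : R) t 1)
        (is_deriveB (is_derive_id t (1 : R)) (is_derive_cst s t 1)).
      by rewrite add0r subr0.
    have d2 : is_derive (1 + (t - s)) (1:R) G (g (1 + (t - s))) by apply: dG; lra.
    have := @is_derive1_comp R G (fun t : R => 1 + (t - s)) t _ _ d2 d1.
    by rewrite mulr1.
  have cF (t : R) : s - 1 < t -> {for t, continuous F}.
    move=> st; apply/differentiable_continuous/derivable1_diffP.
    by have [] := dF t st.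
  have -> : G (1 + T) - G 1 = F (s + T) - F s.
    by rewrite /F subrr addr0; congr (G _ - _); ring.
  rewrite EFinB; apply: continuous_FTC2.
  + by lra.
  + apply: continuous_in_subspaceT => t /set_mem; rewrite /= in_itv/= => /andP[st _].
    apply: (@continuous_comp _ _ _ (fun t => 1 + (t - s)) g).
      by apply: cvgD; [exact: cvg_cst|apply: cvgB; [exact: cvg_id|exact: cvg_cst]].
    by apply: cg; lra.
  + split.
    * move=> t; rewrite in_itv/= => /andP[st _].
      by have [] : is_derive t 1 F (g (1 + (t - s))) by apply: dF; lra.
    * by apply: cvg_at_right_filter; apply: cF; lra.
    * by apply: cvg_at_left_filter; apply: cF; lra.
  + move=> t; rewrite in_itv/= => /andP[st _].
    by rewrite derive1E; have /@derive_val : is_derive t 1 F (g (1 + (t - s))) by apply: dF; lra.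
- pose F (t : R) := - G (1 + (s - t)).
  have dF (t : R) : t < s + 1 -> is_derive t 1 F (g (1 + (s - t))).
    move=> st; have d1 : is_derive t (1:R) (fun t : R => 1 + (s - t)) (- 1).
      have := is_deriveD (is_derive_cst (1 : R) t 1)
        (is_deriveB (is_derive_cst s t 1) (is_derive_id t (1 : R))).
      by rewrite add0r sub0r.
    have d2 : is_derive (1 + (s - t)) (1:R) G (g (1 + (s - t))) by apply: dG; lra.
    have d3 := @is_derive1_comp R G (fun t : R => 1 + (s - t)) t _ _ d2 d1.
    by have := is_deriveN d3; rewrite mulrN1 opprK.
  have cF (t : R) : t < s + 1 -> {for t, continuous F}.
    move=> st; apply/differentiable_continuous/derivable1_diffP.
    by have [] := dF t st.
  have -> : G (1 + T) - G 1 = F s - F (s - T).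
    rewrite /F subrr addr0 (_ : 1 + (s - (s - T)) = 1 + T); ring.
  rewrite EFinB; apply: continuous_FTC2.
  + by lra.
  + apply: continuous_in_subspaceT => t /set_mem; rewrite /= in_itv/= => /andP[_ st].
    apply: (@continuous_comp _ _ _ (fun t => 1 + (s - t)) g).
      by apply: cvgD; [exact: cvg_cst|apply: cvgB; [exact: cvg_cst|exact: cvg_id]].
    by apply: cg; lra.
  + split.
    * move=> t; rewrite in_itv/= => /andP[_ st].
      by have [] : is_derive t 1 F (g (1 + (s - t))) by apply: dF; lra.
    * by apply: cvg_at_right_filter; apply: cF; lra.
    * by apply: cvg_at_left_filter; apply: cF; lra.
  + move=> t; rewrite in_itv/= => /andP[_ st].
    by rewrite derive1E; have /@derive_val : is_derive t 1 F (g (1 + (s - t))) by apply: dF; lra.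
Qed.

End one_over_distance.

Section decay.
Context (R : realType).
Local Notation leb := (@lebesgue_measure R).

(** Subadditivity of a concave power, read off from [x^b = x x^(b-1)] and the
    monotonicity of [x^(b-1)]. *)
Lemma powR_add1_le (b T : R) : 0 < b <= 1 -> 0 < T -> (1 + T) `^ b <= 1 + T `^ b.
Proof.
move=> /andP[b0 b1] T0.
rewrite -(@mulr_powRB1 _ (1 + T))//; last by lra.
rewrite -(@mulr_powRB1 _ T)//; last exact: ltW.
rewrite mulrDl mul1r lerD//.
  by rewrite -[leRHS](powRr0 (1 + T)) ler_powR//; lra.
rewrite ler_pM2l// -(opprB 1 b) !powRN lef_pV2 ?posrE ?powR_gt0//; last by lra.
by apply: ge0_ler_powR; rewrite ?nnegrE; lra.
Qed.

(** The three regimes of the rate: [x^(1-a)/(1-a)] grows like [T^(1-a)] for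
    [a < 1] and is bounded for [a > 1], while for [a = 1] the logarithm of
    [1 + T] is comparable to that of [T] only away from [T = 1]. *)
Lemma powRN_antiderivative (a T0 : R) : 0 < a -> 1 < T0 ->
  exists G : R -> R, (forall x : R, 0 < x -> is_derive x 1 G (x `^ (- a))) /\
  exists2 C : R, 0 < C & forall T, 0 < T -> (a = 1 -> T0 <= T) ->
    G (1 + T) - G 1 <=
    C * (T * (T `^ (- Num.min 1 a) * ln T ^+ (a == 1)%R)).
Proof.
move=> a0 T01.
have [->|a1] := eqVneq a 1.
  exists (@ln R); split.
    by move=> x x0; rewrite powR_inv1; [exact: is_derive1_ln|exact: ltW].
  have lT0 : 0 < ln T0 by exact: ln_gt0.
  have l2 : 0 < ln (2 : R) by apply: ln_gt0; lra.
  (* [ln (1 + T) <= ln 2 + ln T] and [ln 2 <= (ln 2 / ln T0) ln T]. *)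
  exists (ln 2 / ln T0 + 1).
    by rewrite addr_gt0// divr_gt0.
  move=> T Tpos /(_ erefl) T0T; rewrite ln1 subr0 minxx (powR_inv1 (ltW Tpos)).
  rewrite expr1 mulVKf ?gt_eqF//.
  have : ln (1 + T) <= ln (2 * T).
    by rewrite ler_ln ?posrE; lra.
  rewrite lnM ?posrE//.
  move=> /le_trans; apply; rewrite mulrDl mul1r lerD2r mulrAC.
  rewrite ler_pdivlMr// ler_pM2l// ler_ln ?posrE//; lra.
have b0 : 1 - a != 0 by rewrite subr_eq0 eq_sym.
exists (fun x => (1 - a)^-1 * x `^ (1 - a)); split.
  move=> x x0.
  have := is_deriveM (is_derive_cst ((1 - a)^-1 : R) x 1) (is_derive1_powR (1 - a) x0).
  rewrite scaler0 addr0 -[_ *: _]/(_ * _) mulrA mulVf// mul1r.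
  by rewrite (_ : 1 - a - 1 = - a)//; lra.
have [alt1|] := ltP a 1.
  exists (1 - a)^-1; first by rewrite invr_gt0; lra.
  move=> T T0' _; rewrite expr0 mulr1 powR1 mulr1.
  rewrite -[X in _ - X]mulr1 -mulrBr ler_pM2l ?invr_gt0; last by lra.
  rewrite lerBlDr (_ : T `^ (- a) = T `^ (1 - a - 1)); last by congr (_ `^ _); lra.
  rewrite mulr_powRB1; [|exact: ltW|by lra].
  by rewrite [leRHS]addrC powR_add1_le//; lra.
rewrite le_eqVlt eq_sym (negbTE a1)/= => alt1.
exists (a - 1)^-1; first by rewrite invr_gt0; lra.
move=> T T0' _; rewrite expr0 mulr1 powR1 mulr1.
rewrite (powR_inv1 (ltW T0')) divff ?gt_eqF// mulr1.
rewrite -[1 - a]opprB invrN mulNr opprK addrC gerDl oppr_le0.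
by rewrite mulr_ge0 ?powR_ge0// invr_ge0; lra.
Qed.

(** Replaces the truncated power by one that has an elementary antiderivative
    and no singularity at the origin. *)
Lemma le_decay (a u : R) : 0 < a -> 0 <= u ->
  Num.max 1 u `^ (- a) <= 2 `^ a * (1 + u) `^ (- a).
Proof.
move=> a0 u0.
have m0 : 1 <= Num.max 1 u by rewrite le_max lexx.
have um : u <= Num.max 1 u by rewrite le_max lexx orbT.
rewrite !powRN ler_pdivlMr ?powR_gt0//; last by lra.
rewrite mulrC ler_pdivrMr ?powR_gt0//; last by lra.
rewrite -powRM//; last by lra.
by apply: ge0_ler_powR; rewrite ?nnegrE; lra.
Qed.

Lemma integral_decay_le (a T0 : R) : 0 < a -> 1 < T0 ->
  exists2 C : R, 0 < C & forall T, 0 < T -> (a = 1 -> T0 <= T) ->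
    forall s, s \in `[0, T] ->
    (\int[leb]_(t in `[0%R, T]) (Num.max 1 `|t - s| `^ (- a))%:E <=
     (C * (T * (T `^ (- Num.min 1 a) * ln T ^+ (a == 1)%R)))%:E)%E.
Proof.
move=> a0 T01; have [G [dG [C C0 GC]]] := powRN_antiderivative a0 T01.
exists (2 * 2 `^ a * C); first by rewrite !mulr_gt0// powR_gt0.
move=> T T0' aT s; rewrite in_itv/= => /andP[s0 sT].
have dg (x : R) : 0 < x ->
    is_derive x 1 (fun y : R => 2 `^ a * y `^ (- a)) (2 `^ a * (- a * x `^ (- a - 1))).
  by move=> x0; exact: (is_deriveZ (2 `^ a) (is_derive1_powR (- a) x0)).
have dG2 (x : R) : 0 < x ->
    is_derive x 1 (fun y : R => 2 `^ a * G y) (2 `^ a * x `^ (- a)).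
  by move=> x0; exact: (is_deriveZ (2 `^ a) (dG x x0)).
have cg (x : R) : 0 < x -> {for x, continuous (fun y : R => 2 `^ a * y `^ (- a))}.
  move=> x0; apply/differentiable_continuous/derivable1_diffP.
  by have [] := dg x x0.
have [IR IL] := @integral_two_sided R (fun y => 2 `^ a * y `^ (- a))
  (fun y => 2 `^ a * G y) T s T0' dG2 cg.
have mg : measurable_fun setT (fun t : R => (2 `^ a * (1 + `|t - s|) `^ (- a))%:E).
  apply/measurable_EFinP/measurable_funM => //.
  apply: (measurableT_comp (measurable_powR _ )) => //.
  apply: measurable_funD => //.
  by apply: measurableT_comp => //; exact: measurable_funB.
have mmax : measurable_fun setT (fun t : R => Num.max 1 `|t - s|).
  apply: measurable_maxr => //.
  by apply: measurableT_comp => //; exact: measurable_funB.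
have g0 (t : R) : (0 <= (2 `^ a * (1 + `|t - s|) `^ (- a))%:E)%E.
  by rewrite lee_fin mulr_ge0// powR_ge0.
have mB : measurable_fun (`[(s - T)%R, s] `|` `]s, (s + T)%R])
    (fun t : R => (2 `^ a * (1 + `|t - s|) `^ (- a))%:E) by exact: measurable_funTS.
apply: (@le_trans _ _ (\int[leb]_(t in `[0%R, T])
    (2 `^ a * (1 + `|t - s|) `^ (- a))%:E)%E).
  apply: ge0_le_integral => //.
  - apply/measurable_EFinP; apply: measurable_funTS.
    exact: (measurableT_comp (measurable_powR (- a)) mmax).
  - exact: measurable_funTS.
  - by move=> t _; rewrite lee_fin; exact: le_decay.
(* Enlarging [[0, T]] to [[s - T, s + T]] makes both sides of [s] intervals of
   length [T]. *)
apply: (@le_trans _ _ (\int[leb]_(t in `[(s - T)%R, s] `|` `]s, (s + T)%R])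
    (2 `^ a * (1 + `|t - s|) `^ (- a))%:E)%E).
  apply: ge0_subset_integral => //; first exact: measurableU.
  move=> t /=; rewrite !in_itv/= => /andP[t0 tT].
  by have [ts|ts] := leP t s; [left|right]; apply/andP; split; lra.
rewrite ge0_integral_setU//; last first.
  apply/disj_setPS => t [] /=; rewrite !in_itv/= => /andP[_ ts] /andP[st _].
  by move: st; rewrite ltNge ts.
apply: (@le_trans _ _ (\int[leb]_(t in `[(s - T)%R, s])
    (2 `^ a * (1 + `|t - s|) `^ (- a))%:E + \int[leb]_(t in `[s, (s + T)%R])
    (2 `^ a * (1 + `|t - s|) `^ (- a))%:E)%E).
  apply: leeD2l; apply: ge0_subset_integral => //; first exact: measurable_funTS.
  by apply: subset_itvr; rewrite bnd_simp.
have I1 : (\int[leb]_(t in `[s, (s + T)%R]) (2 `^ a * (1 + `|t - s|) `^ (- a))%:E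
    = (2 `^ a * (G (1 + T) - G 1))%:E)%E.
  rewrite mulrBr -IR.
  apply: eq_integral => t /set_mem; rewrite /= in_itv/= => /andP[st _].
  by rewrite ger0_norm//; lra.
have I2 : (\int[leb]_(t in `[(s - T)%R, s]) (2 `^ a * (1 + `|t - s|) `^ (- a))%:E
    = (2 `^ a * (G (1 + T) - G 1))%:E)%E.
  rewrite mulrBr -IL.
  apply: eq_integral => t /set_mem; rewrite /= in_itv/= => /andP[_ st].
  by rewrite ler0_norm ?opprB//; lra.
rewrite I1 I2 -EFinD lee_fin -mulr2n -[leLHS]mulr_natl -!mulrA ler_pM2l//.
by rewrite ler_pM2l ?powR_gt0//; exact: GC.
Qed.

End decay.

(** * Borel measurability in normed spaces *)

Section borel.
Context (R : realType).

Lemma continuous_measurable_borel (V : ptopologicalType) (h : V -> R) :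
  continuous h -> measurable_fun setT (h : borelType V -> R).
Proof.
move=> ch; apply: (measurability _ (RGenOpens.measurableE R)).
move=> _ [_ [a [b ->] <-]]; rewrite setTI.
apply: sub_sigma_algebra; move/continuousP: ch; apply.
exact: interval_open.
Qed.

Lemma continuous_measurable_borelT (V W : ptopologicalType) (h : V -> W) :
  continuous h -> measurable_fun setT (h : borelType V -> borelType W).
Proof.
move=> ch; apply: (@measurability _ _ (borelType V) (borelType W) setT h (@open W)) => //.
move=> _ [U oU <-]; rewrite setTI.
by apply: sub_sigma_algebra; move/continuousP: ch; apply.
Qed.

(** On the product of the Borel sigma-algebras continuity is not enough; with a
    dense sequence [d_], [|x - y| < r] holds exactly when
    [|x - d_ n| + |y - d_ n| < r] for some [n]. *)
Lemma measurable_dist_borel (V : normedModType R) : separable_space V ->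
  measurable_fun setT
    (fun z : borelType V * borelType V => `|(z.1 : V) - (z.2 : V)|).
Proof.
move=> [D [cD dD]].
have [d_ dE] : exists d_ : nat -> V, D `<=` range d_.
  have [g] := pcard_surjP cD.
  move=> gD; exists g => x Dx; by have [n _ <-] := gD x Dx; exists n.
apply: (measurability _ (RGenInftyO.measurableE R)).
move=> _ [_ [r ->] <-]; rewrite setTI.
have mdist (x : V) : measurable_fun setT (fun y : borelType V => `|(y : V) - x|).
  apply: continuous_measurable_borel => y.
  by apply: cvg_norm; apply: cvgB => //; exact: cvg_cst.
rewrite (_ : _ @^-1` _ = \bigcup_n
    ((fun z : borelType V * borelType V => `|(z.1 : V) - d_ n| + `|(z.2 : V) - d_ n|)
      @^-1` `]-oo, r[)).
  apply: bigcupT_measurable => n.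
  rewrite -[X in measurable X]setTI.
  apply: (measurable_funD _ _) => //.
  - exact: (measurableT_comp (mdist (d_ n)) measurable_fst).
  - exact: (measurableT_comp (mdist (d_ n)) measurable_snd).
apply/seteqP; split => -[x y] /=; rewrite in_itv/=; last first.
  move=> [n _]; rewrite /= in_itv/=; apply: le_lt_trans.
  by rewrite (le_trans (ler_distD (d_ n) _ _))// lerD2l distrC.
move=> xyr.
have e0 : 0 < (r - `|x - y|) / 2 by rewrite divr_gt0// subr_gt0.
pose e := (r - `|x - y|) / 2.
have oB : open [set z : V | `|x - z| < e] by have := ball_open x e; rewrite -ball_normE.
have [|z [/= xz Dz]] := dD _ _ oB.
  by exists x; rewrite /= subrr normr0.
have [n _ dn] := dE _ Dz; exists n => //=; rewrite in_itv/= dn.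
have : `|y - z| <= `|x - y| + `|x - z|.
  by rewrite (le_trans (ler_distD x _ _))// lerD2r distrC.
by rewrite /e in xz; lra.
Qed.

End borel.

(** * Integrals of Holder functions and the Wasserstein distance *)

Section equal_laws.
Local Open Scope ereal_scope.
Context (R : realType) (d1 d2 d : measure_display) (T1 : measurableType d1)
  (T2 : measurableType d2) (S : measurableType d)
  (P1 : {measure set T1 -> \bar R}) (P2 : {measure set T2 -> \bar R})
  (phi1 : T1 -> S) (phi2 : T2 -> S).
Hypotheses (m1 : measurable_fun setT phi1) (m2 : measurable_fun setT phi2).
Hypothesis same_law : forall A, measurable A -> P1 (phi1 @^-1` A) = P2 (phi2 @^-1` A).

(** Both integrals are integrals of [h] against the common image measure.
    Working with two maps lets the marginals of a coupling be compared with
    image measures on another space. *)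
Lemma ge0_integral_same_law (h : S -> \bar R) :
  (forall x, 0 <= h x) -> measurable_fun setT h ->
  \int[P1]_x h (phi1 x) = \int[P2]_x h (phi2 x).
Proof.
move=> h0 mh.
have := @ge0_integral_pushforward _ _ _ _ R phi1 m1 P1 setT h measurableT mh
  (fun x _ => h0 x).
have := @ge0_integral_pushforward _ _ _ _ R phi2 m2 P2 setT h measurableT mh
  (fun x _ => h0 x).
rewrite !preimage_setT => <- <-.
apply: eq_measure_integral => A mA _; exact: same_law.
Qed.

Lemma integral_same_law (h : S -> \bar R) : measurable_fun setT h ->
  \int[P1]_x h (phi1 x) = \int[P2]_x h (phi2 x).
Proof.
move=> mh; rewrite integralE [RHS]integralE; congr (_ - _).
- rewrite (funepos_comp h phi1) (funepos_comp h phi2).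
  exact: (ge0_integral_same_law (fun x => funepos_ge0 h x) (measurable_funepos mh)).
- rewrite (funeneg_comp h phi1) (funeneg_comp h phi2).
  exact: (ge0_integral_same_law (fun x => funeneg_ge0 h x) (measurable_funeneg mh)).
Qed.

Lemma integrable_same_law (h : S -> \bar R) : measurable_fun setT h ->
  P2.-integrable setT (h \o phi2) -> P1.-integrable setT (h \o phi1).
Proof.
move=> mh /integrableP[_ hoo]; apply/integrableP; split.
  exact: measurableT_comp.
apply: le_lt_trans hoo.
by rewrite (ge0_integral_same_law (h := fun x => `|h x|))//; exact: measurableT_comp.
Qed.

End equal_laws.

Section holder_growth.
Context (R : realType).

(** Both factors increase when [x] and [y] are replaced by [x + y]. *)
Lemma powR_interpolation (x y c : R) : 0 <= x -> 0 <= y -> 0 <= c <= 1 ->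
  x `^ (1 - c) * y `^ c <= x + y.
Proof.
move=> x0 y0 /andP[c0 c1].
have xy0 : 0 <= x + y by exact: addr_ge0.
apply: (@le_trans _ _ ((x + y) `^ (1 - c) * (x + y) `^ c)).
  by apply: ler_pM; rewrite ?powR_ge0//; apply: ge0_ler_powR; rewrite ?nnegrE; lra.
rewrite -powRD; last by rewrite subrK oner_eq0.
by rewrite subrK powRr1.
Qed.

Lemma le_powR1 (x q : R) : 0 <= x -> 1 <= q -> x <= 1 + x `^ q.
Proof.
move=> x0 q1; have [x1|x1] := leP x 1.
  by rewrite (le_trans x1)// lerDl powR_ge0.
by apply: (le_trans (le1r_powR (ltW x1) q1)); rewrite lerDr.
Qed.

Context (V : normedModType R) (f : V -> R) (p gamma Cf : R).
Hypotheses (p_ge1 : 1 <= p) (gamma_gt0 : 0 < gamma) (gamma_le1 : gamma <= 1)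
  (Cf_gt0 : 0 < Cf).
Hypothesis f_holder : forall x y : V,
  `|f x - f y| <= Cf * (1 + `|x| `^ p + `|y| `^ p) `^ (1 - gamma)
                     * `|x - y| `^ gamma.

(** Compare with the value at the origin. *)
Lemma holder_growth x : `|f x| <= (`|f 0| + 2 * Cf) * (1 + `|x| `^ p).
Proof.
have := f_holder x 0; rewrite normr0 powR0; last by rewrite gt_eqF// (lt_le_trans ltr01).
rewrite addr0 subr0 -mulrA => fx.
have xp := powR_ge0 `|x| p.
have : (1 + `|x| `^ p) `^ (1 - gamma) * `|x| `^ gamma <= 2 * (1 + `|x| `^ p).
  have V0 : 0 <= 1 + `|x| `^ p by rewrite addr_ge0.
  have g01 : 0 <= gamma <= 1 by rewrite (ltW gamma_gt0).
  apply: (le_trans (powR_interpolation V0 (normr_ge0 x) g01)).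
  by rewrite mulr_natl mulr2n lerD2l le_powR1.
rewrite -(ler_pM2l Cf_gt0) => /(le_trans fx) {}fx.
have : `|f x| <= `|f x - f 0| + `|f 0|.
  by rewrite -{1}(subrK (f 0) (f x)) ler_normD.
have := normr_ge0 (f 0); nra.
Qed.

Lemma holder_continuous : continuous f.
Proof.
move=> x; apply/cvgrPdist_le => e e0.
pose M := Cf * (1 + `|x| `^ p + (`|x| + 1) `^ p) `^ (1 - gamma).
have xp := powR_ge0 `|x| p; have xp1 := powR_ge0 (`|x| + 1) p.
have M0 : 0 < M by rewrite mulr_gt0// powR_gt0//; lra.
have eM0 : 0 < (e / M) `^ gamma^-1 by rewrite powR_gt0// divr_gt0.
near=> y.
have xy1 : `|x - y| <= 1 by near: y; apply: cvgr_dist_le => //; exact: cvg_id.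
have xye : `|x - y| <= (e / M) `^ gamma^-1 by near: y; apply: cvgr_dist_le => //; exact: cvg_id.
have yx : `|y| <= `|x| + 1.
  have : `|y| <= `|x| + `|y - x|.
    by rewrite -{1}(subrK x y) addrC (le_trans (ler_normD _ _))// addrC.
  by rewrite distrC; lra.
apply: (le_trans (f_holder x y)).
apply: (@le_trans _ _ (M * (e / M))); last by rewrite mulrC divfK// gt_eqF.
apply: ler_pM; [by rewrite mulr_ge0 ?powR_ge0// ltW|exact: powR_ge0| |].
- rewrite (ler_pM2l Cf_gt0); apply: ge0_ler_powR.
  + by rewrite subr_ge0.
  + by rewrite nnegrE !addr_ge0// powR_ge0.
  + by rewrite nnegrE !addr_ge0// powR_ge0.
  + rewrite lerD2l; apply: ge0_ler_powR => //.
    * by rewrite (le_trans ler01).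
    * by rewrite nnegrE.
    * by rewrite nnegrE addr_ge0.
- apply: (@le_trans _ _ (((e / M) `^ gamma^-1) `^ gamma)).
    apply: ge0_ler_powR => //.
    + exact: ltW.
    + by rewrite nnegrE.
    + by rewrite nnegrE ltW.
  by rewrite -powRrM mulVf ?gt_eqF// powRr1// ltW// divr_gt0.
Unshelve. all: by end_near. Qed.

(** The scale [r] is left free so that it can be matched to the transport cost. *)
Lemma holder_interpolation (r : R) x y : 0 < r ->
  `|f x - f y| <= Cf * r `^ gamma *
    (1 + `|x| `^ p + `|y| `^ p + r^-1 * `|x - y|).
Proof.
move=> r0; apply: (le_trans (f_holder x y)).
have xp := powR_ge0 `|x| p; have yp := powR_ge0 `|y| p.
rewrite -!mulrA ler_pM2l//.
have -> : `|x - y| `^ gamma = r `^ gamma * (r^-1 * `|x - y|) `^ gamma.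
  rewrite -powRM ?mulVKf ?gt_eqF//; first exact: ltW.
  by rewrite mulr_ge0// invr_ge0 ltW.
rewrite mulrCA ler_pM2l ?powR_gt0//; apply: powR_interpolation.
- by lra.
- by rewrite mulr_ge0// invr_ge0 ltW.
- by rewrite (ltW gamma_gt0).
Qed.

End holder_growth.

Section wasserstein_holder.
Context (R : realType) (V : normedModType R) (sepV : separable_space V).
Context (f : V -> R) (p gamma Cf : R).
Hypotheses (p_ge1 : 1 <= p) (gamma_gt0 : 0 < gamma) (gamma_le1 : gamma <= 1)
  (Cf_gt0 : 0 < Cf).
Hypothesis f_holder : forall x y : V,
  `|f x - f y| <= Cf * (1 + `|x| `^ p + `|y| `^ p) `^ (1 - gamma)
                     * `|x - y| `^ gamma.

Let mf : measurable_fun setT (f : borelType V -> R).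
Proof.
apply: continuous_measurable_borel.
exact: (holder_continuous p_ge1 gamma_gt0 gamma_le1 Cf_gt0 f_holder).
Qed.

Let mpow : measurable_fun setT (fun x : borelType V => `|(x : V)| `^ p).
Proof.
apply: (measurableT_comp (measurable_powR p)).
by apply: continuous_measurable_borel; exact: norm_continuous.
Qed.

Lemma integrable_holder d (T : measurableType d) (P : {measure set T -> \bar R})
    (phi : T -> borelType V) (M : R) : P setT = 1%E -> measurable_fun setT phi ->
  (\int[P]_x (`|(phi x : V)| `^ p)%:E <= M%:E)%E ->
  P.-integrable setT (EFin \o (f \o phi)).
Proof.
move=> PT mphi PM; apply/integrableP; split.
  by apply/measurable_EFinP; exact: measurableT_comp.
have C0 : 0 <= `|f 0| + 2 * Cf by rewrite addr_ge0// mulr_ge0// ltW.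
have mpp : measurable_fun setT (fun x => (`|(phi x : V)| `^ p)%:E).
  by apply/measurable_EFinP; exact: (measurableT_comp mpow mphi).
apply: (@le_lt_trans _ _ ((`|f 0| + 2 * Cf)%:E *
    (\int[P]_x (1%:E + (`|(phi x : V)| `^ p)%:E)))%E).
  rewrite -ge0_integralZl_EFin//; last 2 first.
  - by move=> x _; rewrite lee_fin addr_ge0// powR_ge0.
  - by apply: emeasurable_funD.
  apply: ge0_le_integral => //.
  - by apply: measurableT_comp => //; apply/measurable_EFinP; exact: measurableT_comp.
  - by apply: measurable_funeM; exact: emeasurable_funD.
  - move=> x _; rewrite /= lee_fin.
    exact: (holder_growth p_ge1 gamma_gt0 gamma_le1 Cf_gt0 f_holder).
have pp0 x : (0 <= (`|(phi x : V)| `^ p)%:E)%E by rewrite lee_fin powR_ge0.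
have -> : (\int[P]_x (1%:E + (`|(phi x : V)| `^ p)%:E) =
    \int[P]_x 1%:E + \int[P]_x (`|(phi x : V)| `^ p)%:E)%E.
  rewrite (ge0_integralD P measurableT (f1 := fun=> 1%:E) _ _ (fun x _ => pp0 x) mpp)//.
rewrite lte_mul_pinfty//; apply: lte_add_pinfty.
  by rewrite integral_cst//= PT mule1 ltry.
by rewrite (le_lt_trans PM)// ltry.
Qed.

(** The infimum defining the Wasserstein distance need not be attained, but a
    strict upper bound yields a coupling whose cost is below it. *)
Lemma wasserstein1_holder d1 d2 (T1 : measurableType d1) (T2 : measurableType d2)
    (P1 : {measure set T1 -> \bar R}) (P2 : {measure set T2 -> \bar R})
    (phi1 : T1 -> borelType V) (phi2 : T2 -> borelType V) (M1 M2 r B : R) :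
  P1 setT = 1%E -> P2 setT = 1%E ->
  measurable_fun setT phi1 -> measurable_fun setT phi2 ->
  (\int[P1]_x (`|(phi1 x : V)| `^ p)%:E <= M1%:E)%E ->
  (\int[P2]_x (`|(phi2 x : V)| `^ p)%:E <= M2%:E)%E ->
  0 < r ->
  (wasserstein1 (pushforward P1 phi1) (pushforward P2 phi2) < (r * B)%:E)%E ->
  `| \int[P1]_x f (phi1 x) - \int[P2]_x f (phi2 x) | <=
    Cf * r `^ gamma * (1 + M1 + M2 + B).
Proof.
move=> P1T P2T m1 m2 PM1 PM2 r0 /ereal_inf_lt[_ [g gP <-]] costB.
have law1 A : measurable A ->
    g ((fst : borelType V * borelType V -> borelType V) @^-1` A) = P1 (phi1 @^-1` A).
  move=> mA; have [+ _] := gP A mA; rewrite /pushforward => <-.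
  by congr (g _); apply/seteqP; split => [z|z []].
have law2 A : measurable A ->
    g ((snd : borelType V * borelType V -> borelType V) @^-1` A) = P2 (phi2 @^-1` A).
  move=> mA; have [_ +] := gP A mA; rewrite /pushforward => <-.
  by congr (g _); apply/seteqP; split => [z|z []].
have mfst : measurable_fun setT (fst : borelType V * borelType V -> borelType V).
  exact: measurable_fst.
have msnd : measurable_fun setT (snd : borelType V * borelType V -> borelType V).
  exact: measurable_snd.
have i1 := integrable_holder P1T m1 PM1.
have i2 := integrable_holder P2T m2 PM2.
have mfE : measurable_fun setT (EFin \o f : borelType V -> \bar R).
  exact/measurable_EFinP.
have mpE : measurable_fun setT (fun x : borelType V => (`|(x : V)| `^ p)%:E).
  exact/measurable_EFinP.
have j1 := integrable_same_law mfst m1 law1 mfE i1.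
have j2 := integrable_same_law msnd m2 law2 mfE i2.
have eE1 := integral_same_law mfst m1 law1 mfE.
have eE2 := integral_same_law msnd m2 law2 mfE.
have pE1 := ge0_integral_same_law mfst m1 law1
  (h := fun x : borelType V => (`|(x : V)| `^ p)%:E) (fun x => powR_ge0 _ _) mpE.
have pE2 := ge0_integral_same_law msnd m2 law2
  (h := fun x : borelType V => (`|(x : V)| `^ p)%:E) (fun x => powR_ge0 _ _) mpE.
pose D := Cf * r `^ gamma.
have D0 : 0 <= D by rewrite mulr_ge0 ?powR_ge0// ltW.
have mdist := measurable_dist_borel sepV.
have mA : measurable_fun setT (fun z : borelType V * borelType V =>
    (1 + `|(z.1 : V)| `^ p + `|(z.2 : V)| `^ p)%:E).
  apply/measurable_EFinP; apply: measurable_funD.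
    apply: measurable_funD => //; exact: (measurableT_comp mpow mfst).
  exact: (measurableT_comp mpow msnd).
have mB : measurable_fun setT (fun z : borelType V * borelType V =>
    (r^-1 * `|(z.1 : V) - (z.2 : V)|)%:E).
  by apply/measurable_EFinP; apply: measurable_funM.
have A0 (z : borelType V * borelType V) :
    (0 <= (1 + `|(z.1 : V)| `^ p + `|(z.2 : V)| `^ p)%:E)%E.
  by rewrite lee_fin !addr_ge0// powR_ge0.
have B0 (z : borelType V * borelType V) :
    (0 <= (r^-1 * `|(z.1 : V) - (z.2 : V)|)%:E)%E.
  by rewrite lee_fin mulr_ge0// invr_ge0 ltW.
have IA : (\int[g]_z (1 + `|(z.1 : V)| `^ p + `|(z.2 : V)| `^ p)%:E <=
    (1 + M1 + M2)%:E)%E.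
  pose a1 (z : borelType V * borelType V) := (`|(z.1 : V)| `^ p)%:E.
  pose a2 (z : borelType V * borelType V) := (`|(z.2 : V)| `^ p)%:E.
  have a10 z : (0 <= a1 z)%E by rewrite lee_fin powR_ge0.
  have a20 z : (0 <= a2 z)%E by rewrite lee_fin powR_ge0.
  have ma1 : measurable_fun setT a1 by exact: (measurableT_comp mpE mfst).
  have ma2 : measurable_fun setT a2 by exact: (measurableT_comp mpE msnd).
  have a120 z : (0 <= a1 z + a2 z)%E by exact: adde_ge0.
  have ma12 : measurable_fun setT (fun z => a1 z + a2 z)%E.
    exact: emeasurable_funD.
  under eq_integral do rewrite -addrA 2!EFinD.
  rewrite (ge0_integralD g measurableT (f1 := fun=> 1%:E) _ _ (fun z _ => a120 z) ma12)//.
  rewrite (ge0_integralD g measurableT (fun z _ => a10 z) ma1 (fun z _ => a20 z) ma2).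
  rewrite integral_cst//= probability_setT mule1.
  rewrite (_ : (1 + M1 + M2)%:E = 1 + (M1%:E + M2%:E))%E; last first.
    by rewrite -!EFinD addrA.
  apply: leeD2l; apply: leeD.
    by rewrite /a1 pE1.
  by rewrite /a2 pE2.
have IB : (\int[g]_z (r^-1 * `|(z.1 : V) - (z.2 : V)|)%:E <= B%:E)%E.
  have mdE : measurable_fun setT (fun z : borelType V * borelType V =>
      (`|(z.1 : V) - (z.2 : V)|)%:E) by exact/measurable_EFinP.
  have rV0 : 0 <= r^-1 by rewrite invr_ge0 ltW.
  have d0 (z : borelType V * borelType V) : (0 <= (`|(z.1 : V) - (z.2 : V)|)%:E)%E.
    by rewrite lee_fin.
  under eq_integral do rewrite EFinM.
  rewrite (ge0_integralZl_EFin g measurableT (fun z _ => d0 z) mdE rV0).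
  rewrite -[B](mulKf (lt0r_neq0 r0)) EFinM; apply: lee_wpmul2l.
    by rewrite lee_fin.
  exact: ltW.
have AB0 (z : borelType V * borelType V) :
    (0 <= (1 + `|(z.1 : V)| `^ p + `|(z.2 : V)| `^ p)%:E +
     (r^-1 * `|(z.1 : V) - (z.2 : V)|)%:E)%E by exact: adde_ge0.
have mAB := emeasurable_funD mA mB.
have IAB := ge0_integralD g measurableT (fun z _ => A0 z) mA (fun z _ => B0 z) mB.
have IDAB := ge0_integralZl_EFin g measurableT (fun z _ => AB0 z) mAB D0.
rewrite /Rintegral -eE1 -eE2 -lee_fin -/D.
have fin1 := integrable_fin_num measurableT j1.
have fin2 := integrable_fin_num measurableT j2.
rewrite -fineB// -fine_abse; last by rewrite fin_numB fin1.
rewrite fineK; last by rewrite abse_fin_num fin_numB fin1.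
rewrite -integralB//.
apply: (le_trans (le_abse_integral _ _ _)) => //.
  apply: emeasurable_funB; [exact: (measurableT_comp mfE mfst)|].
  exact: (measurableT_comp mfE msnd).
apply: (@le_trans _ _ (D%:E * ((1 + M1 + M2)%:E + B%:E))%E); last first.
  by rewrite -EFinD -EFinM.
apply: (@le_trans _ _ (\int[g]_z (D%:E * ((1 + `|(z.1 : V)| `^ p + `|(z.2 : V)| `^ p)%:E +
     (r^-1 * `|(z.1 : V) - (z.2 : V)|)%:E)))%E).
  apply: ge0_le_integral => //.
  - apply: measurableT_comp => //.
    apply: emeasurable_funB; [exact: (measurableT_comp mfE mfst)|].
    exact: (measurableT_comp mfE msnd).
  - exact: measurable_funeM.
  - move=> z _; rewrite -EFinB/= -EFinD -EFinM lee_fin.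
    exact: (holder_interpolation gamma_gt0 gamma_le1 Cf_gt0 f_holder).
rewrite IDAB IAB; apply: lee_wpmul2l; first by rewrite lee_fin.
exact: leeD.
Qed.

End wasserstein_holder.

(** * Time averages *)

Section time_average.
Context (R : realType).
Local Notation leb := (@lebesgue_measure R).
Local Notation above m I h c :=
  (\int[m]_(t in I) (Num.max (h t - c)%R 0%R)%:E)%E (only parsing).
Local Notation below m I h c :=
  (\int[m]_(t in I) (Num.max (c - h t)%R 0%R)%:E)%E (only parsing).

Lemma measurable_pos_part d (T : measurableType d) (D : set T) (h : T -> R) (c : R) :
  measurable_fun D h -> measurable_fun D (fun x => (Num.max (h x - c) 0)%:E).
Proof.
move=> mh; apply/measurable_EFinP; apply: measurable_maxr => //.
exact: measurable_funB.
Qed.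

Lemma measurable_neg_part d (T : measurableType d) (D : set T) (h : T -> R) (c : R) :
  measurable_fun D h -> measurable_fun D (fun x => (Num.max (c - h x) 0)%:E).
Proof.
move=> mh; apply/measurable_EFinP; apply: measurable_maxr => //.
exact: measurable_funB.
Qed.

Lemma mul_parts_le (x y c : R) :
  Num.max (x - c) 0 * Num.max (c - y) 0 <= (x - c) ^+ 2 + (y - c) ^+ 2.
Proof.
have := sqr_ge0 (x - c); have := sqr_ge0 (y - c).
have := sqr_ge0 ((x - c) + (y - c)).
have [_|_] := leP (x - c) 0; first by rewrite mul0r; lra.
have [_|_] := leP (c - y) 0; first by rewrite mulr0; lra.
rewrite !expr2; nra.
Qed.

(** Since [I] has finite measure, finiteness of the two parts makes [h]
    integrable. *)
Lemma Rintegral_parts d (S : measurableType d) (m : {measure set S -> \bar R})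
    (I : set S) (T c : R) (h : S -> R) :
  measurable I -> m I = T%:E -> measurable_fun I h ->
  (above m I h c < +oo)%E -> (below m I h c < +oo)%E ->
  \int[m]_(t in I) h t =
    fine (above m I h c) - fine (below m I h c) + c * T.
Proof.
move=> mI mIT mh Uoo Voo.
have U0 : (0 <= above m I h c)%E.
  by apply: integral_ge0 => t _; rewrite lee_fin le_max lexx orbT.
have V0 : (0 <= below m I h c)%E.
  by apply: integral_ge0 => t _; rewrite lee_fin le_max lexx orbT.
have iU : m.-integrable I (fun t => (Num.max (h t - c) 0)%:E).
  apply/integrableP; split; first exact: measurable_pos_part.
  apply: le_lt_trans Uoo; rewrite le_eqVlt; apply/orP; left; apply/eqP.
  by apply: eq_integral => t _; rewrite gee0_abs// lee_fin le_max lexx orbT.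
have iV : m.-integrable I (fun t => (Num.max (c - h t) 0)%:E).
  apply/integrableP; split; first exact: measurable_neg_part.
  apply: le_lt_trans Voo; rewrite le_eqVlt; apply/orP; left; apply/eqP.
  by apply: eq_integral => t _; rewrite gee0_abs// lee_fin le_max lexx orbT.
have ic : m.-integrable I (cst c%:E).
  apply/integrableP; split => //.
  by rewrite /= integral_cst// mIT -EFinM ltry.
have E t : (h t)%:E = ((Num.max (h t - c) 0)%:E - (Num.max (c - h t) 0)%:E + c%:E)%E.
  rewrite -EFinB -EFinD; congr EFin.
  by have [|] := leP (h t - c) 0; have [|] := leP (c - h t) 0; lra.
rewrite /Rintegral; under eq_integral do rewrite E.
rewrite integralD//; last exact: integrableB.
rewrite integralB// integral_cst// mIT.
by rewrite -(fineK (_ : (above m I h c) \is a fin_num)) ?ge0_fin_numE//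
  -(fineK (_ : (below m I h c) \is a fin_num)) ?ge0_fin_numE.
Qed.

(** An equality when both parts are integrable.  Otherwise the right-hand side
    is infinite, so that the junk value of the integral of [h] is harmless. *)
Lemma sqr_integral_parts_le d (S : measurableType d) (m : {measure set S -> \bar R})
    (I : set S) (T c : R) (h : S -> R) :
  measurable I -> m I = T%:E -> measurable_fun I h ->
  ((((\int[m]_(t in I) h t)%R - c * T) ^+ 2)%:E +
    2%:E * (above m I h c * below m I h c) <=
   above m I h c * above m I h c + below m I h c * below m I h c)%E.
Proof.
move=> mI mIT mh; have RI := Rintegral_parts (c := c) mI mIT mh; move: RI.
have : (0 <= above m I h c)%E.
  by apply: integral_ge0 => t _; rewrite lee_fin le_max lexx orbT.
have : (0 <= below m I h c)%E.
  by apply: integral_ge0 => t _; rewrite lee_fin le_max lexx orbT.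
move: (above m I h c) (below m I h c) => U V V0 U0 RI.
have [Uoo|] := eqVneq U +oo%E.
  by rewrite Uoo mulyy addye ?leey// gt_eqF// (lt_le_trans _ (mule_ge0 V0 V0)).
rewrite -ltey => Uoo.
have [Voo|] := eqVneq V +oo%E.
  by rewrite Voo mulyy addey ?leey// gt_eqF// (lt_le_trans _ (mule_ge0 U0 U0)).
rewrite -ltey => Voo.
rewrite RI// addrK -(@fineK _ U) ?ge0_fin_numE// -(@fineK _ V) ?ge0_fin_numE//.
rewrite -!EFinM -!EFinD lee_fin /=.
by rewrite le_eqVlt; apply/orP; left; apply/eqP; ring.
Qed.

(** [mean_square_le] for Lebesgue measure on [[0, T]]: the inner integrals of the
    kernel are bounded by [D * B], so the mean square of the integral is at most
    [T * (D * B)].  Restriction to [[0, T]] is by extension by zero, because the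
    product measures are taken over the whole line. *)
Lemma time_average_mean_square d (Omega : measurableType d) (P : probability Omega R)
    (F : R -> Omega -> R) (T c M D B : R) (kappa : R -> R) :
  0 < T ->
  measurable_fun (`[0, T]%classic `*` [set: Omega]) (fun z : R * Omega => F z.1 z.2) ->
  (forall s, s \in `[0, T] -> (\int[P]_w ((F s w - c) ^+ 2)%:E <= M%:E)%E) ->
  0 <= D -> (forall x, 0 <= kappa x) -> measurable_fun setT kappa ->
  (forall s, s \in `[0, T] ->
    (\int[leb]_(t in `[0%R, T]) (kappa `|t - s|)%:E <= B%:E)%E) ->
  (forall s t, s \in `[0, T] -> t \in `[0, T] ->
    (\int[P]_w ((Num.max (F s w - c) 0)%:E * (Num.max (F t w - c) 0)%:E) +
    \int[P]_w ((Num.max (c - F s w) 0)%:E * (Num.max (c - F t w) 0)%:E) <=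
    \int[P]_w ((Num.max (F s w - c) 0)%:E * (Num.max (c - F t w) 0)%:E) +
    \int[P]_w ((Num.max (c - F s w) 0)%:E * (Num.max (F t w - c) 0)%:E) +
    (D * kappa `|t - s|)%:E)%E) ->
  (\int[P]_w ((T^-1 * (\int[leb]_(t in `[0, T]) F t w)%R - c) ^+ 2)%:E <=
   (T^-1 * (D * B))%:E)%E.
Proof.
move=> T0 mF FM D0 k0 mk kB FF.
pose I : set R := `[0, T]%classic.
have mI : measurable I by exact: measurable_itv.
have lebI : leb I = T%:E by rewrite lebesgue_measure_itv/= lte_fin T0 sube0.
have mIO : measurable (I `*` [set: Omega]) by exact: measurableX.
pose u := (fun z : R * Omega => (Num.max (F z.1 z.2 - c) 0)%:E) \_ (I `*` setT).
pose v := (fun z : R * Omega => (Num.max (c - F z.1 z.2) 0)%:E) \_ (I `*` setT).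
have uE t w : u (t, w) = if t \in I then (Num.max (F t w - c) 0)%:E else 0%E.
  by rewrite /u patchE in_setX in_setT andbT.
have vE t w : v (t, w) = if t \in I then (Num.max (c - F t w) 0)%:E else 0%E.
  by rewrite /v patchE in_setX in_setT andbT.
have u0 z : (0 <= u z)%E.
  by case: z => t w; rewrite uE; case: ifP => // _; rewrite lee_fin le_max lexx orbT.
have v0 z : (0 <= v z)%E.
  by case: z => t w; rewrite vE; case: ifP => // _; rewrite lee_fin le_max lexx orbT.
have mu : measurable_fun setT u.
  apply: (measurable_restrictT _ mIO).1.
  exact: (measurable_pos_part c mF).
have mv : measurable_fun setT v.
  apply: (measurable_restrictT _ mIO).1.
  exact: (measurable_neg_part c mF).
have intu w : (\int[leb]_t u (t, w) = \int[leb]_(t in I) (Num.max (F t w - c) 0)%:E)%E.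
  by rewrite [RHS]integral_mkcond; apply: eq_integral => t _; rewrite uE patchE.
have intv w : (\int[leb]_t v (t, w) = \int[leb]_(t in I) (Num.max (c - F t w) 0)%:E)%E.
  by rewrite [RHS]integral_mkcond; apply: eq_integral => t _; rewrite vE patchE.
pose Fp := (fun z : R * Omega => F z.1 z.2) \_ (I `*` setT).
have FpE t w : Fp (t, w) = if t \in I then F t w else 0.
  by rewrite /Fp patchE in_setX in_setT andbT.
have mFp : measurable_fun setT Fp by exact: (measurable_restrictT _ mIO).1 mF.
have mFpE : measurable_fun setT (EFin \o Fp) by exact/measurable_EFinP.
have mFw w : measurable_fun I (fun t => F t w).
  apply: (eq_measurable_fun (fun t => Fp (t, w))).
    by move=> t tI; rewrite FpE tI.
  by apply: measurable_funTS; exact: measurableT_comp.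
have mY : measurable_fun setT (fun w => (\int[leb]_(t in I) F t w)%R - c * T).
  apply: measurable_funB => //; rewrite /Rintegral.
  apply: measurableT_comp => //.
  rewrite (_ : (fun w => _) = (fun w => \int[leb]_t (EFin \o Fp)^\+ (t, w) -
      \int[leb]_t (EFin \o Fp)^\- (t, w))%E).
    apply: emeasurable_funB; apply: measurable_fun_fubini_tonelli_G => //.
    - exact: measurable_funepos.
    - exact: measurable_funeneg.
  apply/funext => w; rewrite integral_mkcond [LHS]integralE.
  by congr (_ - _)%E; apply: eq_integral => t _;
    rewrite ?funeposE ?funenegE /= patchE FpE; case: ifP.
have main : (\int[P]_w (((\int[leb]_(t in I) F t w)%R - c * T) ^+ 2)%:E <=
    (T * (D * B))%:E)%E.
  pose k s t : \bar R := if (s \in I) && (t \in I) then (D * kappa `|t - s|)%:E else 0%E.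
  pose BB s : \bar R := if s \in I then (D * B)%:E else 0%E.
  have zI : 0 \in `[0, T] by rewrite in_itv/= lexx ltW.
  have B0 : 0 <= B.
    by rewrite -lee_fin (le_trans _ (kB 0 zI))//; apply: integral_ge0 => t _; rewrite lee_fin.
  have mkap (s : R) : measurable_fun setT (fun t : R => (D * kappa `|t - s|)%:E).
    apply/measurable_EFinP; apply: measurable_funM => //.
    apply: (measurableT_comp mk); apply: measurableT_comp => //.
    exact: measurable_funB.
  have mBB : measurable_fun setT BB.
    rewrite (_ : BB = cst (D * B)%:E \_ I); first exact: (measurable_restrictT _ mI).1.
    by apply/funext => s; rewrite patchE.
  have intI (x : \bar R) : (\int[leb]_s (if s \in I then x else 0) = x * T%:E)%E.
    rewrite -lebI -integral_cst// [RHS]integral_mkcond.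
    by apply: eq_integral => s _; rewrite patchE.
  apply: (@mean_square_le R _ _ _ _ leb P u v k _ _ u0 mu v0 mv _ _ _ BB).
  - move=> s t; rewrite /k; case: ifP => // _.
    by rewrite lee_fin mulr_ge0.
  - move=> s; have [sI|sI] := boolP (s \in I).
      rewrite (_ : k s = (fun t => (D * kappa `|t - s|)%:E) \_ I).
        by apply: (measurable_restrictT _ mI).1; exact: measurable_funTS.
      by apply/funext => t; rewrite /k sI patchE.
    by rewrite (_ : k s = cst 0%E)//; apply/funext => t; rewrite /k (negbTE sI).
  - move=> s t; rewrite /k.
    have [/andP[sI tI]|] := boolP ((s \in I) && (t \in I)).
    + under eq_integral do rewrite !uE sI tI.
      under [X in (_ + X)%E]eq_integral do rewrite !vE sI tI.
      under [X in (_ <= X + _ + _)%E]eq_integral do rewrite uE vE sI tI.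
      under [X in (_ <= _ + X + _)%E]eq_integral do rewrite uE vE sI tI.
      exact: FF (set_mem sI) (set_mem tI).
    + rewrite negb_and => st.
      by rewrite !integral0_eq ?adde0// => w _; rewrite !(uE, vE);
        case/orP: st => /negbTE ->; rewrite ?mul0e ?mule0.
  - move=> s; rewrite /BB; have [sI|sI] := boolP (s \in I); last first.
      by rewrite /k (negbTE sI)/= integral0.
    rewrite EFinM; apply: (@le_trans _ _ (D%:E * \int[leb]_(t in I) (kappa `|t - s|)%:E)%E).
      rewrite -ge0_integralZl_EFin//; last 2 first.
      - by move=> t _; rewrite lee_fin.
      - apply/measurable_EFinP/measurable_funTS.
        apply: (measurableT_comp mk); apply: measurableT_comp => //.
        exact: measurable_funB.
      rewrite [leRHS]integral_mkcond le_eqVlt; apply/orP; left; apply/eqP.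
      by apply: eq_integral => t _; rewrite /k sI patchE.
    apply: lee_wpmul2l; first by rewrite lee_fin.
    exact: kB (set_mem sI).
  - exact: mBB.
  - by rewrite /BB intI -EFinM mulrC.
  - pose L s := (if s \in I then (2 * M)%:E * T%:E else 0)%E.
    have M0 : 0 <= M.
      rewrite -lee_fin (le_trans _ (FM 0 zI))//.
      by apply: integral_ge0 => w _; rewrite lee_fin sqr_ge0.
    have mFt t : t \in I -> measurable_fun setT (F t).
      move=> tI; rewrite (_ : F t = fun w => Fp (t, w)); first exact: measurableT_comp.
      by apply/funext => w; rewrite FpE tI.
    have uvM s t : (\int[P]_w (u (s, w) * v (t, w)) <=
        if (s \in I) && (t \in I) then (2 * M)%:E else 0)%E.
      have [/andP[sI tI]|] := boolP ((s \in I) && (t \in I)); last first.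
        rewrite negb_and => st; rewrite integral0_eq// => w _; rewrite uE vE.
        by case/orP: st => /negbTE ->; rewrite ?mul0e ?mule0.
      have ms : measurable_fun setT (fun w => ((F s w - c) ^+ 2)%:E).
        apply/measurable_EFinP; apply: measurable_funX.
        by apply: measurable_funB => //; exact: mFt.
      have mt : measurable_fun setT (fun w => ((F t w - c) ^+ 2)%:E).
        apply/measurable_EFinP; apply: measurable_funX.
        by apply: measurable_funB => //; exact: mFt.
      apply: (@le_trans _ _ (\int[P]_w (((F s w - c) ^+ 2)%:E + ((F t w - c) ^+ 2)%:E))%E).
        apply: ge0_le_integral => //.
        + by move=> w _; exact: mule_ge0.
        + by apply: emeasurable_funM; exact: measurableT_comp.
        + exact: emeasurable_funD.
        + move=> w _; rewrite uE vE sI tI -EFinM -EFinD lee_fin.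
          exact: mul_parts_le.
      have pos2 s' w : (0 <= ((F s' w - c) ^+ 2)%:E)%E by rewrite lee_fin sqr_ge0.
      rewrite (ge0_integralD P measurableT (fun w _ => pos2 s w) ms (fun w _ => pos2 t w) mt).
      rewrite mulr_natl mulr2n EFinD.
      by apply: leeD; [exact: FM (set_mem sI)|exact: FM (set_mem tI)].
    apply: (@le_lt_trans _ _ (\int[leb]_s L s)%E); last first.
      by rewrite /L intI -EFinM ltry.
    have uv0 s t : (0 <= \int[P]_w (u (s, w) * v (t, w)))%E.
      by apply: integral_ge0 => w _; exact: mule_ge0.
    have L0 s : (0 <= L s)%E.
      by rewrite /L; case: ifP => // _; rewrite -EFinM lee_fin !mulr_ge0// ltW.
    apply: ge0_le_integral => //.
    + by move=> s _; exact: integral_ge0.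
    + exact: measurable_integral_integral_mul.
    + rewrite (_ : L = cst ((2 * M)%:E * T%:E)%E \_ I); first exact: (measurable_restrictT _ mI).1.
      by apply/funext => s; rewrite patchE.
    + move=> s _; rewrite /L; have [sI|sI] := boolP (s \in I); last first.
        rewrite integral0_eq// => t _; apply/eqP; rewrite eq_le uv0 andbT.
        by have := uvM s t; rewrite (negbTE sI).
      rewrite -intI; apply: ge0_le_integral => //.
      * exact: measurable_integral_mul.
      * rewrite (_ : (fun t => _) = cst (2 * M)%:E \_ I); first exact: (measurable_restrictT _ mI).1.
        by apply/funext => t; rewrite patchE.
      * by move=> t _; have := uvM s t; rewrite sI.
  - exact: mY.
  - move=> w; rewrite intu intv.
    exact: (@sqr_integral_parts_le _ _ leb I T c _ mI lebI (mFw w)).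
have TV : T^-1 * T = 1 by rewrite mulVf// gt_eqF.
have -> : (\int[P]_w ((T^-1 * (\int[leb]_(t in I) F t w)%R - c) ^+ 2)%:E =
    (T^-1 ^+ 2)%:E * \int[P]_w (((\int[leb]_(t in I) F t w)%R - c * T) ^+ 2)%:E)%E.
  rewrite -ge0_integralZl_EFin//; last 3 first.
  - by move=> w _; rewrite lee_fin sqr_ge0.
  - by apply/measurable_EFinP; exact: measurable_funX.
  - by rewrite sqr_ge0.
  apply: eq_integral => w _; rewrite -EFinM -exprMn mulrBr.
  by rewrite (mulrCA T^-1 c T) TV mulr1.
apply: (@le_trans _ _ ((T^-1 ^+ 2)%:E * (T * (D * B))%:E)%E).
  by apply: lee_wpmul2l => //; rewrite lee_fin sqr_ge0.
by rewrite -EFinM lee_fin expr2 -mulrA (mulrA T^-1 T) TV mul1r.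
Qed.

End time_average.

(** * Mixing of the transition semigroup *)

Section moment_bounds.
Context (R : realType).

(** From [h <= c + h^2 / c].  Choosing [c] of the order of the square root of [M]
    replaces the Cauchy-Schwarz inequality. *)
Lemma integral_le_sqr d (T : measurableType d) (P : {measure set T -> \bar R})
    (h : T -> R) (c M : R) : P setT = 1%E -> 0 < c -> (forall x, 0 <= h x) ->
  measurable_fun setT h -> (\int[P]_x (h x ^+ 2)%:E <= M%:E)%E ->
  (\int[P]_x (h x)%:E <= (c + c^-1 * M)%:E)%E.
Proof.
move=> PT c0 h0 mh PM.
have cV0 : 0 <= c^-1 by rewrite invr_ge0 ltW.
have m2 : measurable_fun setT (fun x => (h x ^+ 2)%:E).
  by apply/measurable_EFinP; exact: measurable_funX.
have h20 x : (0 <= (h x ^+ 2)%:E)%E by rewrite lee_fin sqr_ge0.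
have c20 x : (0 <= c^-1%:E * (h x ^+ 2)%:E)%E by rewrite mule_ge0// lee_fin.
have mc2 : measurable_fun setT (fun x => c^-1%:E * (h x ^+ 2)%:E)%E.
  exact: measurable_funeM.
apply: (@le_trans _ _ (\int[P]_x (c%:E + c^-1%:E * (h x ^+ 2)%:E))%E).
  apply: ge0_le_integral => //.
  - by move=> x _; rewrite lee_fin.
  - exact/measurable_EFinP.
  - exact: emeasurable_funD.
  - move=> x _; rewrite -EFinM -EFinD lee_fin -(ler_pM2l c0) mulrDr mulVKf ?gt_eqF//.
    have := sqr_ge0 (c - h x); have := sqr_ge0 (c + h x); rewrite !expr2; nra.
rewrite (ge0_integralD P measurableT (f1 := fun=> c%:E) _ _ (fun x _ => c20 x) mc2)//; last first.
  by move=> x _; rewrite lee_fin ltW.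
rewrite integral_cst//= PT mule1 EFinD EFinM; apply: leeD2l.
rewrite (ge0_integralZl_EFin P measurableT (fun x _ => h20 x) m2 cV0).
by apply: lee_wpmul2l => //; rewrite lee_fin.
Qed.

Lemma powR_double (x q : R) : x `^ (2 * q) = (x `^ q) ^+ 2.
Proof. by rewrite mulrC powRrM powR_mulrn// powR_ge0. Qed.

Lemma linear_continuous_bound (V W : normedModType R) (g : {linear V -> W}) :
  continuous g -> exists2 K : R, 0 < K & forall x, `|g x| <= K * `|x|.
Proof.
move=> cg.
have : bounded_near g (nbhs (0 : V)) by apply: continuous_linear_bounded; exact: cg.
by move=> /linear_boundedP/pinfty_ex_gt0[K K0 gK]; exists K.
Qed.

End moment_bounds.

Section mixing_semigroup.
Context (R : realType) (Z Z0 : completeNormedModType R)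
  (sepZ0 : separable_space Z0) (iota : {linear Z -> Z0})
  (iota_cont : continuous iota)
  (p_ : R -> R.-pker (borelType Z) ~> (borelType Z))
  (mu : probability (borelType Z) R)
  (p lambda gamma Cp Cw Cf : R) (f : Z0 -> R).
Hypotheses (p_ge1 : 1 <= p) (gamma_gt0 : 0 < gamma) (gamma_le1 : gamma <= 1)
  (Cp_gt0 : 0 < Cp) (Cw_gt0 : 0 < Cw) (Cf_gt0 : 0 < Cf).
Hypothesis p_moment : forall (t : R) (x : Z), 0 <= t ->
  (moment (2 * p) (p_ t x) <= (Cp * (1 + `|x| `^ (2 * p)))%:E)%E.
Hypothesis mu_moment : (moment (2 * p) mu < +oo)%E.
Hypothesis mixing : forall (t : R) (xi : Z), 0 <= t ->
  (wasserstein1 (V := Z0)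
     (pushforward (p_ t xi) (iota : borelType Z -> borelType Z0))
     (pushforward mu (iota : borelType Z -> borelType Z0))
   <= (Cw * ((1 + `|xi|) * Num.max 1 t `^ (- lambda)))%:E)%E.
Hypothesis f_holder : forall x y : Z0,
  `|f x - f y| <= Cf * (1 + `|x| `^ p + `|y| `^ p) `^ (1 - gamma)
                     * `|x - y| `^ gamma.

(** The bound comes from [wasserstein1_holder].  What matters is that it grows only
    like [|x|^p] in the starting point, so that its square is controlled by the
    [2 p]-th moment. *)
Lemma semigroup_mixing : exists2 C : R, 0 < C & forall t (x : Z), 0 <= t ->
  (p_ t x).-integrable setT (EFin \o (fun y : borelType Z => f (iota y))) /\
  `|\int[p_ t x]_y f (iota y) - \int[mu]_y f (iota y)| <=
    C * Num.max 1 t `^ (- (gamma * lambda)) * (1 + `|x| `^ p).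
Proof.
have [K K0 iotaK] := linear_continuous_bound iota_cont.
have miota : measurable_fun setT (iota : borelType Z -> borelType Z0).
  exact: continuous_measurable_borelT.
have mpow : measurable_fun setT (fun x : borelType Z => `|(x : Z)| `^ p).
  apply: (measurableT_comp (measurable_powR p)).
  by apply: continuous_measurable_borel; exact: norm_continuous.
have p0 : 0 <= p by rewrite (le_trans ler01).
(* Used with [c] equal to [1 + |x|^p] for the kernel and to [1] for [mu]. *)
have image_moment (Q : {measure set (borelType Z) -> \bar R}) (c M : R) :
    Q setT = 1%E -> 0 < c -> (moment (2 * p) Q <= M%:E)%E ->
    (\int[Q]_y (`|iota y| `^ p)%:E <= (K `^ p * (c + c^-1 * M))%:E)%E.
  move=> QT c0 QM.
  have Kp0 : 0 <= K `^ p by exact: powR_ge0.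
  have pp0 (y : borelType Z) : (0 <= (`|(y : Z)| `^ p)%:E)%E by rewrite lee_fin powR_ge0.
  have mpE : measurable_fun setT (fun y : borelType Z => (`|(y : Z)| `^ p)%:E).
    exact/measurable_EFinP.
  apply: (@le_trans _ _ ((K `^ p)%:E * \int[Q]_y (`|(y : Z)| `^ p)%:E)%E).
    rewrite -(ge0_integralZl_EFin Q measurableT (fun y _ => pp0 y) mpE Kp0).
    apply: ge0_le_integral => //.
    - apply/measurable_EFinP; apply: (measurableT_comp (measurable_powR p)).
      apply: (measurableT_comp _ miota).
      by apply: continuous_measurable_borel; exact: norm_continuous.
    - exact: measurable_funeM.
    - move=> y _; rewrite -EFinM lee_fin -(powRM _ (ltW K0))//.
      apply: ge0_ler_powR => //; rewrite nnegrE//.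
      by rewrite mulr_ge0// ltW.
  rewrite EFinM; apply: lee_wpmul2l; first by rewrite lee_fin.
  apply: (integral_le_sqr QT c0 (h := fun y : borelType Z => `|(y : Z)| `^ p)) => //.
  apply: le_trans QM; rewrite le_eqVlt; apply/orP; left; apply/eqP.
  by apply: eq_integral => y _; rewrite powR_double.
pose m := fine (moment (2 * p) mu).
have mE : moment (2 * p) mu = m%:E.
  rewrite /m fineK// ge0_fin_numE//; apply: integral_ge0 => y _.
  by rewrite lee_fin powR_ge0.
have m0 : 0 <= m.
  by rewrite -lee_fin -mE; apply: integral_ge0 => y _; rewrite lee_fin powR_ge0.
pose M2 := K `^ p * (1 + m).
have mu_M2 : (\int[mu]_y (`|iota y| `^ p)%:E <= M2%:E)%E.
  have := image_moment mu 1 m (@probability_setT _ _ _ mu) ltr01.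
  by rewrite mE invr1 mul1r; exact.
have Kp0 : 0 <= K `^ p by exact: powR_ge0.
have M20 : 0 <= M2 by rewrite mulr_ge0// addr_ge0.
exists (Cf * (1 + K `^ p * (1 + Cp) + M2 + 4 * Cw)).
  by rewrite mulr_gt0// ltr_wpDl ?mulr_gt0// !addr_ge0// mulr_ge0// addr_ge0// ltW.
move=> t x t0.
pose v := 1 + `|x| `^ p; have xp := powR_ge0 `|x| p.
have v1 : 1 <= v by rewrite lerDl.
have v0 : 0 < v by exact: lt_le_trans v1.
have PT : p_ t x setT = 1%E by exact: prob_kernel.
pose M1 := K `^ p * ((1 + Cp) * v).
have P_M1 : (\int[p_ t x]_y (`|iota y| `^ p)%:E <= M1%:E)%E.
  apply: (le_trans (image_moment _ _ _ PT v0 (p_moment x t0))).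
  rewrite lee_fin /M1 ler_wpM2l//.
  have : v^-1 * (Cp * (1 + `|x| `^ (2 * p))) <= Cp * v.
    rewrite mulrC ler_pdivrMr// -mulrA ler_pM2l// powR_double /v !expr2; nra.
  by lra.
split.
  exact: (integrable_holder p_ge1 gamma_gt0 gamma_le1 Cf_gt0 f_holder PT miota P_M1).
pose r := Num.max 1 t `^ (- lambda).
have max0 : 0 < Num.max 1 t by rewrite lt_max ltr01.
have r0 : 0 < r by rewrite powR_gt0.
have x0 : 0 < 1 + `|x| by rewrite ltr_wpDr.
(* The factor 2 makes the inequality strict, as needed to pick a coupling. *)
have W : (wasserstein1 (V := Z0)
     (pushforward (p_ t x) (iota : borelType Z -> borelType Z0))
     (pushforward mu (iota : borelType Z -> borelType Z0)) <
     (r * (2 * Cw * (1 + `|x|)))%:E)%E.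
  apply: (le_lt_trans (mixing x t0)); rewrite lte_fin -/r.
  have : 0 < Cw * (1 + `|x|) * r by rewrite !mulr_gt0.
  by rewrite -mulrA; lra.
have := wasserstein1_holder sepZ0 p_ge1 gamma_gt0 gamma_le1 Cf_gt0 f_holder
  PT (@probability_setT _ _ _ mu) miota miota P_M1 mu_M2 r0 W.
move=> /le_trans; apply.
rewrite /r -powRrM mulNr (mulrC lambda).
rewrite [leRHS](_ : _ = Cf * Num.max 1 t `^ (- (gamma * lambda)) *
    ((1 + K `^ p * (1 + Cp) + M2 + 4 * Cw) * v)); last by rewrite /v; ring.
apply: ler_wpM2l; first by rewrite mulr_ge0 ?powR_ge0// ltW.
have xv : 1 + `|x| <= 2 * v.
  by have := le_powR1 (normr_ge0 x) p_ge1; rewrite /v; lra.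
have : M2 <= M2 * v by rewrite ler_peMr.
have : 2 * Cw * (1 + `|x|) <= 4 * Cw * v.
  rewrite (_ : 4 * Cw * v = 2 * Cw * (2 * v)); last by ring.
  by rewrite ler_pM2l// mulr_gt0.
by rewrite /M1 mulrA; move: (K `^ p * (1 + Cp)) => q; rewrite !mulrDl mul1r; lra.
Qed.

End mixing_semigroup.

(** * Decorrelation along the process *)

Section centred_parts.
Context (R : realType).
Local Notation above m I h c :=
  (\int[m]_(t in I) (Num.max (h t - c)%R 0%R)%:E)%E (only parsing).
Local Notation below m I h c :=
  (\int[m]_(t in I) (Num.max (c - h t)%R 0%R)%:E)%E (only parsing).

(** Writing a bound on the mean of a signed function as two inequalities between
    integrals of nonnegative functions, which can be integrated again without
    any integrability condition. *)
Lemma integral_parts_le d (S : measurableType d) (Q : {measure set S -> \bar R})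
    (h : S -> R) (c D : R) : Q setT = 1%E -> Q.-integrable setT (EFin \o h) ->
  `|\int[Q]_x h x - c| <= D ->
  (above Q setT h c <= below Q setT h c + D%:E)%E /\
  (below Q setT h c <= above Q setT h c + D%:E)%E.
Proof.
move=> QT /[dup] ih /integrableP[mh hoo].
have {}mh : measurable_fun setT h by exact/measurable_EFinP.
have mabs : measurable_fun setT (fun x => `|(h x)%:E|%E).
  by apply: measurableT_comp => //; exact/measurable_EFinP.
have abs0 x : (0 <= `|(h x)%:E|)%E by exact: abse_ge0.
have sum_oo : (\int[Q]_x (`|(h x)%:E| + `|c|%:E) < +oo)%E.
  rewrite (ge0_integralD Q measurableT (fun x _ => abs0 x) mabs (f2 := fun=> `|c|%:E))//.
  by rewrite integral_cst//= QT mule1 lte_add_pinfty ?ltry.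
have le_oo (g : S -> R) : (forall x, 0 <= g x <= `|h x| + `|c|) ->
    measurable_fun setT (EFin \o g) -> (\int[Q]_x (g x)%:E < +oo)%E.
  move=> gle mg; apply: le_lt_trans sum_oo; apply: ge0_le_integral => //.
  - by move=> x _; rewrite lee_fin; case/andP: (gle x).
  - exact: emeasurable_funD.
  - by move=> x _; rewrite abse_EFin -EFinD lee_fin; case/andP: (gle x).
have Uoo : (above Q setT h c < +oo)%E.
  apply: le_oo; last exact: measurable_pos_part.
  move=> x; rewrite le_max lexx orbT/= ge_max addr_ge0// andbT.
  exact: le_trans (ler_norm _) (ler_normB _ _).
have Voo : (below Q setT h c < +oo)%E.
  apply: le_oo; last exact: measurable_neg_part.
  move=> x; rewrite le_max lexx orbT/= ge_max addr_ge0// andbT.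
  by rewrite [leRHS]addrC; exact: le_trans (ler_norm _) (ler_normB _ _).
have -> := Rintegral_parts (c := c) measurableT QT mh Uoo Voo.
have U0 : (0 <= above Q setT h c)%E.
  by apply: integral_ge0 => t _; rewrite lee_fin le_max lexx orbT.
have V0 : (0 <= below Q setT h c)%E.
  by apply: integral_ge0 => t _; rewrite lee_fin le_max lexx orbT.
move: (above Q setT h c) (below Q setT h c) Uoo Voo U0 V0 => U V Uoo Voo U0 V0.
rewrite mulr1 addrK ler_norml => /andP[DUV UVD].
rewrite -(@fineK _ U) ?ge0_fin_numE// -(@fineK _ V) ?ge0_fin_numE//.
by rewrite -!EFinD !lee_fin; split; lra.
Qed.

End centred_parts.

Section two_times.
Local Open Scope ereal_scope.
Context (R : realType) (d : measure_display) (S : measurableType d)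
  (dO : measure_display) (Omega : measurableType dO)
  (P : probability Omega R) (k : R.-pker S ~> S) (X Y : Omega -> S).
Hypotheses (mX : measurable_fun setT X) (mY : measurable_fun setT Y).
Hypothesis XY : forall A B, measurable A -> measurable B ->
  P (X @^-1` A `&` Y @^-1` B) = \int[P]_(w in X @^-1` A) k (X w) B.

(** The Markov property turns the second factor into its integral against [k],
    where [b] and [b'] can be compared pointwise; [a <= G V] then leaves the
    second moment of [V]. *)
Lemma markov_integral_mul_le (a b b' V : S -> R) (D G M : R) :
  (forall x, 0 <= a x)%R -> measurable_fun setT a ->
  (forall x, 0 <= b x)%R -> measurable_fun setT b ->
  (forall x, 0 <= b' x)%R -> measurable_fun setT b' ->
  (forall x, 0 <= V x)%R -> measurable_fun setT V ->
  (0 <= D)%R -> (0 <= G)%R ->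
  (forall x, a x <= G * V x)%R ->
  \int[P]_w (V (X w) ^+ 2)%:E <= M%:E ->
  (forall x, \int[k x]_y (b y)%:E <= \int[k x]_y (b' y)%:E + (D * V x)%:E) ->
  \int[P]_w ((a (X w))%:E * (b (Y w))%:E) <=
  \int[P]_w ((a (X w))%:E * (b' (Y w))%:E) + (D * (G * M))%:E.
Proof.
move=> a0 ma b0 mb b'0 mb' V0 mV D0 G0 aV VM kbb.
have maE : measurable_fun setT (EFin \o a) by exact/measurable_EFinP.
have mbE : measurable_fun setT (EFin \o b) by exact/measurable_EFinP.
have mbE' : measurable_fun setT (EFin \o b') by exact/measurable_EFinP.
rewrite (markov_integral_mul mX mY XY (a := EFin \o a) (b := EFin \o b))//.
rewrite (markov_integral_mul mX mY XY (a := EFin \o a) (b := EFin \o b'))//.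
have maX : measurable_fun setT (fun w => (a (X w))%:E).
  exact: (measurableT_comp maE mX).
have mk (g : S -> R) : (forall x, 0 <= g x)%R -> measurable_fun setT g ->
    measurable_fun setT (fun w => \int[k (X w)]_y (g y)%:E).
  move=> g0 mg.
  have mkg : measurable_fun setT (fun x => \int[k x]_y (g y)%:E).
    apply: measurable_fun_integral_kernel => //.
    - by move=> U mU; exact: measurable_kernel.
    - exact/measurable_EFinP.
  exact: (measurableT_comp mkg mX).
have kg0 (g : S -> R) x : (forall x, 0 <= g x)%R -> 0 <= \int[k x]_y (g y)%:E.
  by move=> g0; apply: integral_ge0 => y _; rewrite lee_fin.
have m2 : measurable_fun setT (fun w => (V (X w) ^+ 2)%:E).
  by apply/measurable_EFinP; apply: measurable_funX; exact: (measurableT_comp mV mX).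
have V20 w : 0 <= (V (X w) ^+ 2)%:E by rewrite lee_fin sqr_ge0.
have A0 w : 0 <= (a (X w))%:E * \int[k (X w)]_y (b' y)%:E.
  by rewrite mule_ge0 ?lee_fin// kg0.
have mA : measurable_fun setT (fun w => (a (X w))%:E * \int[k (X w)]_y (b' y)%:E).
  by apply: emeasurable_funM => //; exact: mk.
have DG0 : (0 <= D * G)%R by exact: mulr_ge0.
have B0 w : 0 <= (D * G)%:E * (V (X w) ^+ 2)%:E by rewrite mule_ge0.
have mB : measurable_fun setT (fun w => (D * G)%:E * (V (X w) ^+ 2)%:E).
  exact: measurable_funeM.
apply: (@le_trans _ _ (\int[P]_w ((a (X w))%:E * \int[k (X w)]_y (b' y)%:E
    + (D * G)%:E * (V (X w) ^+ 2)%:E))).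
  apply: ge0_le_integral => //.
  - by move=> w _; rewrite mule_ge0 ?lee_fin// kg0.
  - by apply: emeasurable_funM => //; exact: mk.
  - exact: emeasurable_funD.
  move=> w _; apply: (@le_trans _ _ ((a (X w))%:E *
      (\int[k (X w)]_y (b' y)%:E + (D * V (X w))%:E))).
    by apply: lee_wpmul2l; [rewrite lee_fin|exact: kbb].
  rewrite ge0_muleDr ?kg0 ?lee_fin ?mulr_ge0//; apply: leeD2l.
  rewrite -!EFinM lee_fin.
  rewrite (_ : D * G * V (X w) ^+ 2 = G * V (X w) * (D * V (X w)))%R; last by ring.
  by apply: ler_wpM2r; [exact: mulr_ge0|exact: aV].
rewrite (ge0_integralD P measurableT (fun w _ => A0 w) mA (fun w _ => B0 w) mB).
apply: leeD2l.
rewrite (ge0_integralZl_EFin P measurableT (fun w _ => V20 w) m2 DG0).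
by rewrite mulrA (EFinM (D * G) M); apply: lee_wpmul2l; rewrite ?lee_fin.
Qed.

(** This is [E ((h X - c) (h Y - c)) <= 2 G D M] with the product expanded into
    parts and the negative terms moved to the right-hand side. *)
Lemma markov_decorrelation (h V : S -> R) (c D G M : R) :
  measurable_fun setT h -> (forall x, 0 <= V x)%R -> measurable_fun setT V ->
  (0 <= D)%R -> (0 <= G)%R -> (forall x, `|h x - c| <= G * V x)%R ->
  \int[P]_w (V (X w) ^+ 2)%:E <= M%:E ->
  (forall x, (k x).-integrable setT (EFin \o h)) ->
  (forall x, `|(\int[k x]_y h y)%R - c| <= D * V x)%R ->
  \int[P]_w ((Num.max (h (X w) - c) 0)%:E * (Num.max (h (Y w) - c) 0)%:E) +
  \int[P]_w ((Num.max (c - h (X w)) 0)%:E * (Num.max (c - h (Y w)) 0)%:E) <=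
  \int[P]_w ((Num.max (h (X w) - c) 0)%:E * (Num.max (c - h (Y w)) 0)%:E) +
  \int[P]_w ((Num.max (c - h (X w)) 0)%:E * (Num.max (h (Y w) - c) 0)%:E) +
  (2 * G * D * M)%:E.
Proof.
move=> mh V0 mV D0 G0 hG VM ih hD.
have mpos : measurable_fun setT (fun x => Num.max (h x - c) 0)%R.
  by apply: measurable_maxr => //; exact: measurable_funB.
have mneg : measurable_fun setT (fun x => Num.max (c - h x) 0)%R.
  by apply: measurable_maxr => //; exact: measurable_funB.
have pos0 x : (0 <= Num.max (h x - c) 0)%R by rewrite le_max lexx orbT.
have neg0 x : (0 <= Num.max (c - h x) 0)%R by rewrite le_max lexx orbT.
have GV0 x : (0 <= G * V x)%R by exact: mulr_ge0.
have posG x : (Num.max (h x - c) 0 <= G * V x)%R.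
  by rewrite ge_max GV0 andbT; exact: le_trans (ler_norm _) (hG x).
have negG x : (Num.max (c - h x) 0 <= G * V x)%R.
  by rewrite ge_max GV0 andbT; apply: le_trans (ler_norm _) _; rewrite distrC.
have parts x := integral_parts_le (prob_kernel x) (ih x) (hD x).
have pp := markov_integral_mul_le pos0 mpos pos0 mpos neg0 mneg V0 mV D0 G0
  posG VM (fun x => proj1 (parts x)).
have nn := markov_integral_mul_le neg0 mneg neg0 mneg pos0 mpos V0 mV D0 G0
  negG VM (fun x => proj2 (parts x)).
apply: (le_trans (leeD pp nn)).
rewrite addeACA leeD2l// -EFinD lee_fin le_eqVlt; apply/orP; left; apply/eqP.
by ring.
Qed.

Lemma markov_integral_pushforward (b : S -> \bar R) :
  (forall x, 0 <= b x) -> measurable_fun setT b ->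
  \int[P]_w b (Y w) = \int[P]_w \int[k (X w)]_y b y.
Proof.
move=> b0 mb; have := markov_integral_on mX mY XY measurableT b0 mb.
by rewrite preimage_setT.
Qed.

End two_times.

Lemma markov_process_two_times (R : realType) d (S : measurableType d)
    dO (Omega : measurableType dO) (P : probability Omega R)
    (p_ : R -> R.-pker S ~> S) (X : R -> Omega -> S) (s t : R) :
  markov_process P p_ X -> 0 <= s -> s <= t ->
  forall A B, measurable A -> measurable B ->
  P (X s @^-1` A `&` X t @^-1` B) =
  (\int[P]_(w in X s @^-1` A) p_ (t - s)%R (X s w) B)%E.
Proof.
move=> [mX mark] s0 st A B mA mB.
have ts0 : 0 <= t - s by rewrite subr_ge0.
have := mark s (t - s) s0 ts0 (X s @^-1` A) _ B mB.
rewrite subrKC; apply.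
apply: sub_sigma_algebra; exists s, A; split => //.
by rewrite s0 lexx.
Qed.

Lemma markov_process_moment (R : realType) (Z : normedModType R)
    dO (Omega : measurableType dO) (P : probability Omega R)
    (p_ : R -> R.-pker (borelType Z) ~> (borelType Z))
    (X : R -> Omega -> borelType Z) (q Cq s : R) :
  markov_process P p_ X -> 0 <= Cq ->
  (forall t (x : Z), 0 <= t ->
    (moment q (p_ t x) <= (Cq * (1 + `|x| `^ q))%:E)%E) ->
  0 <= s ->
  (\int[P]_w (`|(X s w : Z)| `^ q)%:E <=
   Cq%:E * (1 + \int[P]_w (`|(X 0 w : Z)| `^ q)%:E))%E.
Proof.
move=> Xmarkov Cq0 pM s0.
have mX t : 0 <= t -> measurable_fun setT (X t) by exact: (proj1 Xmarkov).
have mX0 := mX 0 (lexx 0).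
have mpow : measurable_fun setT (fun x : borelType Z => (`|(x : Z)| `^ q)%:E).
  apply/measurable_EFinP; apply: (measurableT_comp (measurable_powR q)).
  by apply: continuous_measurable_borel; exact: norm_continuous.
have pow0 (x : borelType Z) : (0 <= (`|(x : Z)| `^ q)%:E)%E.
  by rewrite lee_fin powR_ge0.
have mpX0 : measurable_fun setT (fun w => (`|(X 0 w : Z)| `^ q)%:E).
  exact: (measurableT_comp mpow mX0).
have sum0 w : (0 <= 1 + (`|(X 0 w : Z)| `^ q)%:E)%E by rewrite adde_ge0.
have msum : measurable_fun setT (fun w => 1 + (`|(X 0 w : Z)| `^ q)%:E)%E.
  exact: emeasurable_funD.
rewrite (markov_integral_pushforward mX0 (mX s s0)
  (markov_process_two_times Xmarkov (lexx 0) s0) pow0 mpow).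
apply: (@le_trans _ _ (\int[P]_w (Cq%:E * (1 + (`|(X 0 w : Z)| `^ q)%:E)))%E).
  apply: ge0_le_integral => //.
  - by move=> w _; exact: integral_ge0.
  - have mk : measurable_fun setT (fun x : borelType Z =>
        \int[p_ (s - 0)%R x]_y (`|(y : Z)| `^ q)%:E)%E.
      apply: measurable_fun_integral_kernel => //.
      by move=> U mU; exact: measurable_kernel.
    exact: (measurableT_comp mk mX0).
  - exact: measurable_funeM.
  - move=> w _; rewrite -EFinD -EFinM; apply: pM.
    by rewrite subr0.
rewrite (ge0_integralZl_EFin P measurableT (fun w _ => sum0 w) msum Cq0).
rewrite (ge0_integralD P measurableT (f1 := fun=> 1%:E) _ _
  (fun w _ => pow0 (X 0 w)) mpX0)//.
by rewrite integral_cst//= probability_setT mule1.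
Qed.

(** * The law of large numbers *)

Theorem theorem4p1 (R : realType)
  (Z Z0 : completeNormedModType R)
  (hilbert_Z : hilbert_norm Z) (hilbert_Z0 : hilbert_norm Z0)
  (separable_Z : separable_space Z) (separable_Z0 : separable_space Z0)
  (iota : {linear Z -> Z0})
  (iota_inj : injective iota) (iota_cont : continuous iota)
  (p_ : R -> R.-pker (borelType Z) ~> (borelType Z))
  (p_transition : transition_kernels p_) (p_feller : Cb_Feller p_)
  (p : R) (p_ge1 : 1 <= p)
  (p_moment : exists2 Cp : R, 0 < Cp & forall (t : R) (x : Z), 0 <= t ->
     (moment (2 * p) (p_ t x) <= (Cp * (1 + `|x| `^ (2 * p)))%:E)%E)
  (mu : probability (borelType Z) R)
  (mu_moment : (moment (2 * p) mu < +oo)%E)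
  (mu_invariant : unique_invariant_measure p_ mu)
  (lambda : R) (lambda_gt0 : 0 < lambda)
  (mixing : exists2 Cw : R, 0 < Cw & forall (t : R) (xi : Z), 0 <= t ->
     (wasserstein1 (V := Z0)
        (pushforward (p_ t xi) (iota : borelType Z -> borelType Z0))
        (pushforward mu (iota : borelType Z -> borelType Z0))
      <= (Cw * ((1 + `|xi|) * Num.max 1 t `^ (- lambda)))%:E)%E)
  (gamma : R) (gamma_gt0 : 0 < gamma) (gamma_le1 : gamma <= 1)
  (f : Z0 -> R)
  (f_holder : exists2 Cf : R, 0 < Cf & forall x y : Z0,
     `|f x - f y| <= Cf * (1 + `|x| `^ p + `|y| `^ p) `^ (1 - gamma)
                        * `|x - y| `^ gamma)
  (T0 : R) (T0_gt1 : 1 < T0) :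
  exists2 C : R, 0 < C &
  forall (d : measure_display) (Omega : measurableType d)
    (P : probability Omega R) (X : R -> Omega -> borelType Z),
  markov_process P p_ X -> measurable_process X ->
  forall T : R, 0 < T -> (gamma * lambda = 1 -> T0 <= T) ->
  ('E_P[fun w =>
       (`| T^-1 * (\int[lebesgue_measure]_(t in `[0, T]) f (iota (X t w)))
           - \int[mu]_x f (iota x) | ^+ 2)%R]
   <= C%:E * (1 + 'E_P[fun w => (`| (X 0 w : Z) | `^ (2 * p))%R]
                + moment (2 * p) mu)
      * (T `^ (- Num.min 1 (gamma * lambda))
         * ln T ^+ (gamma * lambda == 1)%R)%:E)%E.
Proof.
move: p_moment mixing f_holder => [Cp Cp0 pM] [Cw Cw0 mixW] [Cf Cf0 fH].
have [C1 C10 mixC] := semigroup_mixing separable_Z0 iota_cont p_ge1 gamma_gt0 gamma_le1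
  Cp0 Cw0 Cf0 pM mu_moment mixW fH.
pose a := gamma * lambda.
have a0 : 0 < a by exact: mulr_gt0.
have [C2 C20 decayC] := integral_decay_le a0 T0_gt1.
pose c := \int[mu]_x f (iota x).
pose V (x : borelType Z) : R := 1 + `|(x : Z)| `^ p.
have V1 x : 1 <= V x by rewrite lerDl powR_ge0.
have V0 x : 0 <= V x by exact: le_trans (V1 x).
have [K K0 iotaK] := linear_continuous_bound iota_cont.
have [G G0 fG] : exists2 G, 0 < G & forall x : Z, `|f (iota x) - c| <= G * V x.
  have Kp0 : 0 <= K `^ p by exact: powR_ge0.
  have C0 : 0 < `|f 0| + 2 * Cf by rewrite ltr_wpDl// mulr_gt0.
  exists ((`|f 0| + 2 * Cf) * (1 + K `^ p) + `|c|).
    by rewrite ltr_pwDl// mulr_gt0// ltr_pwDl.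
  move=> x; have xp := powR_ge0 `|x| p.
  apply: (le_trans (ler_normB _ _)); rewrite mulrDl; apply: lerD; last by rewrite ler_peMr.
  apply: (le_trans (holder_growth p_ge1 gamma_gt0 gamma_le1 Cf0 fH (iota x))).
  rewrite -mulrA ler_pM2l//.
  have : `|iota x| `^ p <= K `^ p * `|x| `^ p.
    rewrite -(powRM _ (ltW K0))//; apply: ge0_ler_powR => //.
    - by rewrite (le_trans ler01).
    - by rewrite nnegrE.
    - by rewrite nnegrE mulr_ge0// ltW.
  by rewrite /V; nra.
have miota : measurable_fun setT (iota : borelType Z -> borelType Z0).
  exact: continuous_measurable_borelT.
have mf : measurable_fun setT (fun x : borelType Z => f (iota x)).
  have mfZ0 : measurable_fun setT (f : borelType Z0 -> R).
    apply: continuous_measurable_borel.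
    exact: (holder_continuous p_ge1 gamma_gt0 gamma_le1 Cf0 fH).
  exact: (measurableT_comp mfZ0 miota).
have mnorm : measurable_fun setT (fun x : borelType Z => `|(x : Z)|).
  by apply: continuous_measurable_borel; exact: norm_continuous.
have mpow q : measurable_fun setT (fun x : borelType Z => `|(x : Z)| `^ q).
  exact: (measurableT_comp (measurable_powR q) mnorm).
have mV : measurable_fun setT V by exact: measurable_funD.
have m0 : (0 <= moment (2 * p) mu)%E.
  by apply: integral_ge0 => y _; rewrite lee_fin powR_ge0.
exists (2 * G * C1 * (2 * (1 + Cp)) * C2).
  by rewrite !mulr_gt0// addr_gt0.
move=> d Omega P X Xmarkov Xmeas T Tpos aT.
pose rate := T `^ (- Num.min 1 (gamma * lambda)) * ln T ^+ (gamma * lambda == 1)%R.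
have rate0 : 0 < rate.
  rewrite mulr_gt0 ?powR_gt0//.
  have [a1|a1] := eqVneq (gamma * lambda) 1; last by rewrite expr0.
  by rewrite expr1 ln_gt0// (lt_le_trans T0_gt1)// aT.
have mX t : 0 <= t -> measurable_fun setT (X t) by exact: (proj1 Xmarkov).
rewrite unlock -/rate.
have X0ge0 : (0 <= \int[P]_w (`|(X 0 w : Z)| `^ (2 * p))%:E)%E.
  by apply: integral_ge0 => w _; rewrite lee_fin powR_ge0.
(* If the initial moment is infinite, so is the right-hand side, because the
   rate does not vanish. *)
have [X0oo|] := eqVneq (\int[P]_w (`|(X 0 w : Z)| `^ (2 * p))%:E)%E +oo%E.
  have Cpos : 0 < 2 * G * C1 * (2 * (1 + Cp)) * C2 by rewrite !mulr_gt0// addr_gt0.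
  rewrite X0oo addey// addye; last by rewrite gt_eqF// (lt_le_trans _ m0).
  by rewrite gt0_muley ?lte_fin// gt0_mulye ?lte_fin// leey.
rewrite -ltey => X0fin.
pose E0 := fine (\int[P]_w (`|(X 0 w : Z)| `^ (2 * p))%:E)%E.
have E0E : (\int[P]_w (`|(X 0 w : Z)| `^ (2 * p))%:E)%E = E0%:E.
  by rewrite /E0 fineK// ge0_fin_numE.
have E00 : 0 <= E0 by rewrite -lee_fin -E0E.
(* From [V^2 <= 2 (1 + |x|^(2p))] and the moment bound of the kernels. *)
pose M := 2 * (1 + Cp) * (1 + E0).
have VM s : 0 <= s -> (\int[P]_w (V (X s w) ^+ 2)%:E <= M%:E)%E.
  move=> s0.
  have pow0 w : (0 <= (`|(X s w : Z)| `^ (2 * p))%:E)%E by rewrite lee_fin powR_ge0.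
  have mpX : measurable_fun setT (fun w => (`|(X s w : Z)| `^ (2 * p))%:E).
    by apply/measurable_EFinP; exact: (measurableT_comp (mpow _) (mX s s0)).
  have sum0 w : (0 <= 1 + (`|(X s w : Z)| `^ (2 * p))%:E)%E by rewrite adde_ge0.
  have msum : measurable_fun setT (fun w => 1 + (`|(X s w : Z)| `^ (2 * p))%:E)%E.
    exact: emeasurable_funD.
  apply: (@le_trans _ _ (\int[P]_w (2%:E * (1 + (`|(X s w : Z)| `^ (2 * p))%:E)))%E).
    apply: ge0_le_integral => //.
    - by move=> w _; rewrite lee_fin sqr_ge0.
    - apply/measurable_EFinP; apply: measurable_funX.
      exact: (measurableT_comp mV (mX s s0)).
    - exact: measurable_funeM.
    - move=> w _; rewrite -EFinD -EFinM lee_fin powR_double /V.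
      move: (`|(X s w : Z)| `^ p) => v.
      by have := sqr_ge0 (1 - v); rewrite !expr2; lra.
  rewrite (ge0_integralZl_EFin P measurableT (fun w _ => sum0 w) msum (ler0n R 2)).
  rewrite (ge0_integralD P measurableT (f1 := fun=> 1%:E) _ _ (fun w _ => pow0 w) mpX)//.
  rewrite integral_cst//= probability_setT mule1.
  have := markov_process_moment Xmarkov (ltW Cp0) pM s0.
  rewrite E0E -EFinD -EFinM => /(leeD2l 1%:E) XsM.
  apply: (@le_trans _ _ (2%:E * (1 + (Cp * (1 + E0))%:E))%E).
    by apply: lee_wpmul2l.
  by rewrite -EFinD -EFinM lee_fin /M -mulrA ler_pM2l// mulrDl mul1r lerD2r lerDl.
pose kappa u := Num.max 1 u `^ (- a).
have kappa0 u : 0 <= kappa u by exact: powR_ge0.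
have mkappa : measurable_fun setT kappa.
  apply: (measurableT_comp (measurable_powR (- a))).
  exact: measurable_maxr.
pose D := 2 * G * C1 * M.
pose pos t w : \bar R := (Num.max (f (iota (X t w)) - c) 0)%:E.
pose neg t w : \bar R := (Num.max (c - f (iota (X t w))) 0)%:E.
(* Only [s <= t] comes from the Markov property; the other order follows by
   symmetry below. *)
have decorr s t : 0 <= s -> s <= t ->
  (\int[P]_w (pos s w * pos t w) + \int[P]_w (neg s w * neg t w) <=
   \int[P]_w (pos s w * neg t w) + \int[P]_w (neg s w * pos t w) +
   (D * kappa (t - s))%:E)%E.
  move=> s0 st; have t0 := le_trans s0 st.
  have ts0 : 0 <= t - s by rewrite subr_ge0.
  have k0 : 0 <= C1 * kappa (t - s) by rewrite mulr_ge0// ltW.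
  have := markov_decorrelation (mX s s0) (mX t t0)
    (markov_process_two_times Xmarkov s0 st) mf V0 mV k0 (ltW G0) fG (VM s s0)
    (fun x => proj1 (mixC (t - s) x ts0)) (fun x => proj2 (mixC (t - s) x ts0)).
  by rewrite (_ : 2 * G * (C1 * kappa (t - s)) * M = D * kappa (t - s))//
    /D; ring.
have sq_bound s : s \in `[0, T] ->
  (\int[P]_w ((f (iota (X s w)) - c) ^+ 2)%:E <= (G ^+ 2 * M)%:E)%E.
  rewrite in_itv/= => /andP[s0 _].
  have mV2 : measurable_fun setT (fun w => (V (X s w) ^+ 2)%:E).
    apply/measurable_EFinP; apply: measurable_funX.
    exact: (measurableT_comp mV (mX s s0)).
  have V20 w : (0 <= (V (X s w) ^+ 2)%:E)%E by rewrite lee_fin sqr_ge0.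
  rewrite EFinM; apply: (@le_trans _ _ ((G ^+ 2)%:E * \int[P]_w (V (X s w) ^+ 2)%:E)%E).
    rewrite -(ge0_integralZl_EFin P measurableT (fun w _ => V20 w) mV2 (sqr_ge0 G)).
    apply: ge0_le_integral => //.
    - by move=> w _; rewrite lee_fin sqr_ge0.
    - apply/measurable_EFinP; apply: measurable_funX; apply: measurable_funB => //.
      exact: (measurableT_comp mf (mX s s0)).
    - exact: measurable_funeM.
    - move=> w _; rewrite -EFinM lee_fin -exprMn -[leLHS]real_normK ?num_real//.
      by rewrite ler_pXn2r ?nnegrE// mulr_ge0// ltW.
  by apply: lee_wpmul2l; [rewrite lee_fin sqr_ge0|exact: VM].
have mF : measurable_fun (`[0, T]%classic `*` [set: Omega])
    (fun z : R * Omega => f (iota (X z.1 z.2))).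
  have XI : measurable_fun (`[0, T]%classic `*` [set: Omega])
      (fun z : R * Omega => X z.1 z.2).
    apply: measurable_funS Xmeas.
    - apply: measurableX => //.
      by rewrite (_ : [set t | 0 <= t] = `[0, +oo[%classic)//; apply/seteqP; split => t /=;
        rewrite in_itv/= andbT.
    - by move=> [t w] /= [+ _]; rewrite in_itv/= => /andP[].
  exact: (measurableT_comp mf XI).
pose B := C2 * (T * rate).
have M0 : 0 <= M by rewrite !mulr_ge0// addr_ge0// ltW.
have D0 : 0 <= D by apply: mulr_ge0 => //; rewrite !mulr_ge0// ltW.
have kB s : s \in `[0, T] ->
    (\int[lebesgue_measure]_(t in `[0%R, T]) (kappa `|t - s|)%:E <= B%:E)%E.
  by move=> sT; exact: (decayC T Tpos aT s sT).
have FF s t : s \in `[0, T] -> t \in `[0, T] ->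
  (\int[P]_w (pos s w * pos t w) + \int[P]_w (neg s w * neg t w) <=
   \int[P]_w (pos s w * neg t w) + \int[P]_w (neg s w * pos t w) +
   (D * kappa `|t - s|)%:E)%E.
  rewrite !in_itv/= => /andP[s0 _] /andP[t0 _].
  have [st|/ltW ts] := leP s t.
    by rewrite ger0_norm ?subr_ge0//; exact: decorr.
  rewrite distrC ger0_norm ?subr_ge0//; have := decorr t s t0 ts.
  have muleC_integral (g h : Omega -> \bar R) :
      (\int[P]_w (g w * h w) = \int[P]_w (h w * g w))%E.
    by apply: eq_integral => w _; rewrite muleC.
  rewrite (muleC_integral (pos t) (pos s)) (muleC_integral (neg t) (neg s)).
  rewrite (muleC_integral (pos t) (neg s)) (muleC_integral (neg t) (pos s)).
  by rewrite (addeC (\int[P]_w (neg s w * pos t w))%E).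
have main := @time_average_mean_square R d Omega P (fun t w => f (iota (X t w))) T c
  (G ^+ 2 * M) D B kappa Tpos mF sq_bound D0 kappa0 mkappa kB FF.
apply: (@le_trans _ _ (T^-1 * (D * B))%:E).
  apply: le_trans main; rewrite le_eqVlt; apply/orP; left; apply/eqP.
  by apply: eq_integral => w _; rewrite real_normK ?num_real.
rewrite (_ : T^-1 * (D * B) =
    2 * G * C1 * (2 * (1 + Cp)) * C2 * (1 + E0) * rate); last first.
  by rewrite /D /B /M; field; rewrite gt_eqF.
rewrite EFinM; apply: lee_wpmul2r; first by rewrite lee_fin ltW.
rewrite EFinM; apply: lee_wpmul2l.
  by rewrite lee_fin !mulr_ge0 ?addr_ge0// ltW.
by rewrite E0E -EFinD leeDl.
Qed.
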